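(* Let $R$ be a commutative ring and let $\mathcal{C}$ be a Hom-reflexive Krull-Schmidt tri-exact $R$-category. (1) There exist almost split sequences on the right (respectively, left) in $\mathcal{C}$ if and only if $\mathcal{C}$ admits a full right (respectively, left) Auslander-Reiten functor. (2) There exist almost split sequences in $\mathcal{C}$ if and only if $\mathcal{C}$ admits a right Auslander-Reiten equivalence, or equivalently, a left Auslander-Reiten equivalence; and in this case, $\mathcal{C}$ is Ext-reflexive.
   Context: $I_R$ is a minimal injective co-generator for $\mathrm{Mod}\,R$ and $D=\mathrm{Hom}_R(-,I_R)$. An $R$-module $U$ is reflexive if the canonical map $U\to D^2U$ is bijective. A tri-exact $R$-category is a full subcategory $\mathcal{C}$ (containing $0$) of a triangulated $R$-category $\mathcal{A}$ which is extension-closed: for any exact triangle $X\to Y\to Z\to X[1]$ in $\mathcal{A}$ with $X,Z\in\mathcal{C}$, also $Y\in\mathcal{C}$. Put $\mathrm{Ext}^1_{\mathcal{C}}(X,Y)=\mathrm{Hom}_{\mathcal{A}}(X,Y[1])$, functorial by composition ($\delta\cdot f=\delta\circ f$, $g\cdot\delta=g[1]\circ\delta$). $\mathcal{C}$ is Hom-reflexive (resp. Ext-reflexive) if $\mathrm{Hom}_{\mathcal{C}}(X,Y)$ (resp. $\mathrm{Ext}^1_{\mathcal{C}}(X,Y)$) is a reflexive $R$-module for all $X,Y\in\mathcal{C}$. An object is strongly indecomposable if its endomorphism ring is local; $\mathcal{C}$ is Krull-Schmidt if every non-zero object is a finite direct sum of strongly indecomposable objects. A morphism $f:X\to Y$ in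 $\mathcal{C}$ is injectively trivial if $\mathrm{Ext}^1_{\mathcal{C}}(M,f)=0$ for all $M\in\mathcal{C}$, projectively trivial if $\mathrm{Ext}^1_{\mathcal{C}}(f,M)=0$ for all $M\in\mathcal{C}$. $\overline{\mathcal{C}}$ (resp. $\underline{\mathcal{C}}$) is the quotient of $\mathcal{C}$ by the ideal of injectively (resp. projectively) trivial morphisms, with Hom-modules $\overline{\mathrm{Hom}}_{\mathcal{C}}$ (resp. $\underline{\mathrm{Hom}}_{\mathcal{C}}$). An object $X$ is Ext-injective (resp. Ext-projective) if $\mathrm{Ext}^1_{\mathcal{C}}(M,X)=0$ (resp. $\mathrm{Ext}^1_{\mathcal{C}}(X,M)=0$) for all $M\in\mathcal{C}$. A morphism $f:X\to Y$ is left minimal if every $h:Y\to Y$ with $hf=f$ is an automorphism; left almost split if it is not a section and every non-section $X\to M$ factors through $f$; minimal left almost split if both; the right versions are dual. An almost split sequence in $\mathcal{C}$ is a sequence $X\xrightarrow{f}Y\xrightarrow{g}Z$ in $\mathcal{C}$ embedding in an exact triangle $X\to Y\to Z\to X[1]$ of $\mathcal{A}$, with $f$ minimal left almost split and $g$ minimal right almost split in $\mathcal{C}$; $X$ is its starting term and $Z$ its ending term. $\mathcal{C}$ has almost split sequences on the right (resp. left) if every strongly indecomposable not Ext-projective (resp. not Ext-injective) object is the ending (resp. starting) term of an almost split sequence; it has almost split sequences if it has them on the right and on the left. A right Auslander-Reiten functor for $\mathcal{C}$ is a functor $\tau:\underline{\mathcal{C}}\to\overline{\mathcal{C}}$ with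 binatural $R$-linear isomorphisms $\underline{\mathrm{Hom}}_{\mathcal{C}}(X,Y)\to D\,\mathrm{Ext}^1_{\mathcal{C}}(Y,\tau X)$ for $X,Y\in\mathcal{C}$. A left Auslander-Reiten functor for $\mathcal{C}$ is a functor $\tau^-:\overline{\mathcal{C}}\to\underline{\mathcal{C}}$ with binatural $R$-linear isomorphisms $\overline{\mathrm{Hom}}_{\mathcal{C}}(X,Y)\to D\,\mathrm{Ext}^1_{\mathcal{C}}(\tau^-Y,X)$ for $X,Y\in\mathcal{C}$. A right (left) Auslander-Reiten equivalence is a right (left) Auslander-Reiten functor that is an equivalence of categories. *)

(* Defs.v *)
From HB Require Import structures.
From mathcomp Require Import all_boot all_algebra.
From mathcomp Require Import boolp.

Set Implicit Arguments.
Unset Strict Implicit.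
Unset Printing Implicit Defensive.

Import GRing.Theory.
Local Open Scope ring_scope.
Local Open Scope quotient_scope.

Definition lin_hom (R : comPzRingType) (U V : lmodType R) := {linear U -> V}.

Section LinHom.
Variables (R : comPzRingType) (U V : lmodType R).
Implicit Types f g h : lin_hom U V.

HB.instance Definition _ := gen_eqMixin (lin_hom U V).
HB.instance Definition _ := gen_choiceMixin (lin_hom U V).

Lemma lin_hom_ext f g : f =1 g -> f = g.
Proof.
case: f g => [f cf] [g cg] /= /funext fg.
subst g; congr GRing.Linear.Pack.
case: cf cg => [[af] [sf]] [[ag] [sg]].
by rewrite (Prop_irrelevance af ag) (Prop_irrelevance sf sg).
Qed.

Definition lin_zero : lin_hom U V := \0.
Definition lin_opp f : lin_hom U V := \- f.
Definition lin_add f g : lin_hom U V := f \+ g.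
Definition lin_scale (a : R) f : lin_hom U V := a \*: f.

Lemma lin_addA : associative lin_add.
Proof. by move=> f g h; apply: lin_hom_ext => x /=; rewrite addrA. Qed.
Lemma lin_addC : commutative lin_add.
Proof. by move=> f g; apply: lin_hom_ext => x /=; rewrite addrC. Qed.
Lemma lin_add0 : left_id lin_zero lin_add.
Proof. by move=> f; apply: lin_hom_ext => x /=; rewrite add0r. Qed.
Lemma lin_addN : left_inverse lin_zero lin_opp lin_add.
Proof. by move=> f; apply: lin_hom_ext => x /=; rewrite addNr. Qed.

HB.instance Definition _ :=
  GRing.isZmodule.Build (lin_hom U V) lin_addA lin_addC lin_add0 lin_addN.

Lemma lin_scaleA a b f : lin_scale a (lin_scale b f) = lin_scale (a * b) f.
Proof. by apply: lin_hom_ext => x /=; rewrite scalerA. Qed.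
Lemma lin_scale1 : left_id 1 lin_scale.
Proof. by move=> f; apply: lin_hom_ext => x /=; rewrite scale1r. Qed.
Lemma lin_scaleDr : right_distributive lin_scale +%R.
Proof. by move=> a f g; apply: lin_hom_ext => x /=; rewrite scalerDr. Qed.
Lemma lin_scaleDl f : {morph lin_scale^~ f : a b / a + b}.
Proof. by move=> a b; apply: lin_hom_ext => x /=; rewrite scalerDl. Qed.

HB.instance Definition _ := GRing.Zmodule_isLmodule.Build R (lin_hom U V)
  lin_scaleA lin_scale1 lin_scaleDr lin_scaleDl.
End LinHom.

Definition injective_module (R : comPzRingType) (I : lmodType R) : Prop :=
  forall (M N : lmodType R) (u : {linear M -> N}) (f : {linear M -> I}),
    injective u -> exists g : {linear N -> I}, forall x, g (u x) = f x.

Definition cogenerator (R : comPzRingType) (I : lmodType R) : Prop :=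
  forall (M : lmodType R) (x : M), x != 0 ->
    exists f : {linear M -> I}, f x != 0.

(* Minimality: I embeds in every injective co-generator.  By Bumby's theorem
   this determines I up to isomorphism, as the injective envelope of the direct
   sum of a full set of pairwise non-isomorphic simple modules. *)
Definition minimal_injective_cogenerator (R : comPzRingType)
    (I : lmodType R) : Prop :=
  [/\ injective_module I, cogenerator I
    & forall J : lmodType R, injective_module J -> cogenerator J ->
        exists u : {linear I -> J}, injective u].

Section Duality.
Variables (R : comPzRingType) (I : lmodType R).

Definition dual (U : lmodType R) : lmodType R := lin_hom U I.

Definition evalD (U : lmodType R) (x : U) (phi : dual U) : I :=
  (phi : {linear U -> I}) x.

Lemma evalD_linear (U : lmodType R) (x : U) : linear (evalD x).
Proof. by []. Qed.

HB.instance Definition _ (U : lmodType R) (x : U) :=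
  GRing.isLinear.Build R (dual U) I *:%R (evalD x) (evalD_linear x).

Definition bidual (U : lmodType R) (x : U) : dual (dual U) :=
  (evalD x : {linear dual U -> I}).

Definition reflexive_module (U : lmodType R) : Prop := bijective (@bidual U).
End Duality.

Record submodule (R : pzRingType) (V : lmodType R) := Submodule {
  submod_mem :> {pred V};
  submod_memP : submod_closed submod_mem
}.

Section QuotientModule.
Variables (R : pzRingType) (V : lmodType R) (S : submodule V).

Definition submod_pred : {pred V} := submod_mem S.

HB.instance Definition _ :=
  GRing.isZmodClosed.Build V submod_pred
    (GRing.submod_closedB (submod_memP S)).

Definition quot_mod : Type := Quotient.quot submod_pred.
HB.instance Definition _ := GRing.Zmodule.on quot_mod.

Definition quot_pi (x : V) : quot_mod := \pi_(Quotient.quot submod_pred) x.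
Definition quot_repr (x : quot_mod) : V :=
  repr (x : Quotient.quot submod_pred).

Lemma quot_reprK x : quot_pi (quot_repr x) = x.
Proof. exact: reprK. Qed.

Lemma quot_piP x y : quot_pi x = quot_pi y <-> x - y \in submod_pred.
Proof. by rewrite Quotient.idealrBE; split => /eqP. Qed.

Lemma quot_repr_pi x : quot_repr (quot_pi x) - x \in submod_pred.
Proof. by apply/quot_piP; rewrite quot_reprK. Qed.

Lemma quot_piD x y : quot_pi (x + y) = quot_pi x + quot_pi y.
Proof. exact: Quotient.pi_add. Qed.

Lemma submod_predZ a x : x \in submod_pred -> a *: x \in submod_pred.
Proof.
case: (submod_memP S) => S0 SD Sx.
by rewrite -[_ *: _]addr0; apply: SD.
Qed.

Definition quot_scale (a : R) (x : quot_mod) : quot_mod :=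
  quot_pi (a *: quot_repr x).

Lemma quot_scale_pi a x : quot_scale a (quot_pi x) = quot_pi (a *: x).
Proof.
by apply/quot_piP; rewrite -scalerBr; apply/submod_predZ/quot_repr_pi.
Qed.

Lemma quot_scaleA a b x : quot_scale a (quot_scale b x) = quot_scale (a * b) x.
Proof. by rewrite -[x]quot_reprK !quot_scale_pi scalerA. Qed.
Lemma quot_scale1 : left_id 1 quot_scale.
Proof. by move=> x; rewrite -[x]quot_reprK !quot_scale_pi scale1r. Qed.
Lemma quot_scaleDr : right_distributive quot_scale +%R.
Proof.
move=> a x y; rewrite -[x]quot_reprK -[y]quot_reprK.
by rewrite -quot_piD !quot_scale_pi -quot_piD scalerDr.
Qed.
Lemma quot_scaleDl x : {morph quot_scale^~ x : a b / a + b}.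
Proof.
by move=> a b; rewrite -[x]quot_reprK !quot_scale_pi -quot_piD scalerDl.
Qed.

HB.instance Definition _ := GRing.Zmodule_isLmodule.Build R quot_mod
  quot_scaleA quot_scale1 quot_scaleDr quot_scaleDl.
End QuotientModule.

Record rcat (R : comPzRingType) := Rcat {
  ob :> Type;
  hom : ob -> ob -> lmodType R;
  idm : forall X, hom X X;
  comp : forall X Y Z, hom Y Z -> hom X Y -> hom X Z;
  comp_linl : forall X Y Z (f : hom X Y), linear (fun g : hom Y Z => comp g f);
  comp_linr : forall X Y Z (g : hom Y Z), linear (fun f : hom X Y => comp g f);
  compA : forall X Y Z W (h : hom Z W) (g : hom Y Z) (f : hom X Y),
    comp h (comp g f) = comp (comp h g) f;
  comp1m : forall X Y (f : hom X Y), comp (idm Y) f = f;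
  compm1 : forall X Y (f : hom X Y), comp f (idm X) = f
}.
Arguments hom {R r} X Y.
Arguments idm {R r} X.
Arguments comp {R r X Y Z} g f.

Notation "g \c f" := (comp g f) (at level 40, left associativity).

Section Morphisms.
Variables (R : comPzRingType) (C : rcat R).
Implicit Types X Y Z M : C.

Definition is_zero X : Prop :=
  forall M, (forall f : hom X M, f = 0) /\ (forall f : hom M X, f = 0).

Definition is_iso X Y (f : hom X Y) : Prop :=
  exists g : hom Y X, g \c f = idm X /\ f \c g = idm Y.

Definition is_section X Y (f : hom X Y) : Prop :=
  exists r : hom Y X, r \c f = idm X.

Definition is_retraction X Y (f : hom X Y) : Prop :=
  exists s : hom Y X, f \c s = idm Y.

(* The empty sum (n = 0) is a zero object. *)
Definition is_direct_sum n (Y : 'I_n -> C) X : Prop :=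
  exists (i : forall k, hom (Y k) X) (p : forall k, hom X (Y k)),
    [/\ forall k, p k \c i k = idm (Y k),
        forall j k, j != k -> p j \c i k = 0
      & \sum_(k < n) (i k \c p k) = idm X].

Definition additive_rcat : Prop :=
  forall n (Y : 'I_n -> C), exists X, is_direct_sum Y X.

(* The ring hom X X is local: it is non-zero, and its non-units are closed
   under addition. *)
Definition strongly_indecomposable X : Prop :=
  idm X <> 0 /\
  forall f g : hom X X, ~ is_iso f -> ~ is_iso g -> ~ is_iso (f + g).

Definition krull_schmidt : Prop :=
  forall X, ~ is_zero X ->
    exists n (Y : 'I_n -> C),
      (forall k, strongly_indecomposable (Y k)) /\ is_direct_sum Y X.

Definition left_minimal X Y (f : hom X Y) : Prop :=
  forall h : hom Y Y, h \c f = f -> is_iso h.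

Definition left_almost_split X Y (f : hom X Y) : Prop :=
  ~ is_section f /\
  forall M (u : hom X M), ~ is_section u -> exists v : hom Y M, u = v \c f.

Definition right_minimal Y Z (g : hom Y Z) : Prop :=
  forall h : hom Y Y, g \c h = g -> is_iso h.

Definition right_almost_split Y Z (g : hom Y Z) : Prop :=
  ~ is_retraction g /\
  forall M (u : hom M Z), ~ is_retraction u -> exists v : hom M Y, u = g \c v.

Definition hom_reflexive (I : lmodType R) : Prop :=
  forall X Y, reflexive_module I (hom X Y).
End Morphisms.

Record functor (R : comPzRingType) (C D : rcat R) := Functor {
  fob :> C -> D;
  fmor : forall X Y : C, hom X Y -> hom (fob X) (fob Y);
  fmor_id : forall X, fmor (idm X) = idm (fob X);
  fmor_comp : forall X Y Z (g : hom Y Z) (f : hom X Y),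
    fmor (g \c f) = fmor g \c fmor f
}.
Arguments fmor {R C D} f0 {X Y} f.

Definition functor_id (R : comPzRingType) (C : rcat R) : functor C C :=
  @Functor R C C id (fun X Y f => f) (fun X => erefl) (fun X Y Z g f => erefl).

Section FunctorComp.
Variables (R : comPzRingType) (C D E : rcat R).
Variables (G : functor D E) (F : functor C D).

Lemma functor_comp_id X : fmor G (fmor F (idm X)) = idm (G (F X)).
Proof. by rewrite !fmor_id. Qed.

Lemma functor_comp_comp X Y Z (g : hom Y Z) (f : hom X Y) :
  fmor G (fmor F (g \c f)) = fmor G (fmor F g) \c fmor G (fmor F f).
Proof. by rewrite !fmor_comp. Qed.

Definition functor_comp : functor C E :=
  Functor functor_comp_id functor_comp_comp.
End FunctorComp.

Section FunctorProperties.
Variables (R : comPzRingType) (C D : rcat R).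

Definition naturally_isomorphic (F G : functor C D) : Prop :=
  exists eta : forall X : C, hom (F X) (G X),
    (forall X, is_iso (eta X)) /\
    (forall X Y (f : hom X Y), eta Y \c fmor F f = fmor G f \c eta X).

Definition linear_functor (F : functor C D) : Prop :=
  forall X Y : C, linear (fun f : hom X Y => fmor F f).

Definition full_functor (F : functor C D) : Prop :=
  forall (X Y : C) (g : hom (F X) (F Y)), exists f : hom X Y, fmor F f = g.
End FunctorProperties.

Definition equivalence_functor (R : comPzRingType) (C D : rcat R)
    (F : functor C D) : Prop :=
  exists G : functor D C,
    naturally_isomorphic (functor_comp G F) (functor_id C) /\
    naturally_isomorphic (functor_comp F G) (functor_id D).

Section TriangleAxioms.
Variables (R : comPzRingType) (A : rcat R) (T : functor A A).
Variable exact_tri : forall X Y Z : A, hom X Y -> hom Y Z -> hom Z (T X) -> Prop.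

Definition tri_iso_closed : Prop :=
  forall (X Y Z X' Y' Z' : A)
    (u : hom X Y) (v : hom Y Z) (w : hom Z (T X))
    (u' : hom X' Y') (v' : hom Y' Z') (w' : hom Z' (T X'))
    (a : hom X X') (b : hom Y Y') (c : hom Z Z'),
    is_iso a -> is_iso b -> is_iso c ->
    b \c u = u' \c a -> c \c v = v' \c b -> fmor T a \c w = w' \c c ->
    exact_tri u v w -> exact_tri u' v' w'.

Definition tri_trivial : Prop :=
  forall X Z : A, is_zero Z ->
    exact_tri (idm X) (0 : hom X Z) (0 : hom Z (T X)).

Definition tri_cone : Prop :=
  forall (X Y : A) (u : hom X Y),
    exists (Z : A) (v : hom Y Z) (w : hom Z (T X)), exact_tri u v w.

Definition tri_rotate : Prop :=
  forall (X Y Z : A) (u : hom X Y) (v : hom Y Z) (w : hom Z (T X)),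
    exact_tri u v w <-> exact_tri v w (- fmor T u).

Definition tri_morphism : Prop :=
  forall (X Y Z X' Y' Z' : A)
    (u : hom X Y) (v : hom Y Z) (w : hom Z (T X))
    (u' : hom X' Y') (v' : hom Y' Z') (w' : hom Z' (T X'))
    (a : hom X X') (b : hom Y Y'),
    exact_tri u v w -> exact_tri u' v' w' -> b \c u = u' \c a ->
    exists c : hom Z Z', c \c v = v' \c b /\ fmor T a \c w = w' \c c.

Definition tri_octahedron : Prop :=
  forall (X Y Z U V W : A)
    (f : hom X Y) (f' : hom Y U) (f'' : hom U (T X))
    (g : hom Y Z) (g' : hom Z V) (g'' : hom V (T Y))
    (h' : hom Z W) (h'' : hom W (T X)),
    exact_tri f f' f'' -> exact_tri g g' g'' -> exact_tri (g \c f) h' h'' ->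
    exists (a : hom U W) (b : hom W V),
      exact_tri a b (fmor T f' \c g'') /\
      [/\ a \c f' = h' \c g, h'' \c a = f'',
          b \c h' = g' & g'' \c b = fmor T f \c h''].
End TriangleAxioms.

(* The translation functor is only required to be an auto-equivalence, which
   includes the case of an automorphism. *)
Record tricat (R : comPzRingType) := Tricat {
  tricat_rcat :> rcat R;
  tricat_additive : additive_rcat tricat_rcat;
  shift : functor tricat_rcat tricat_rcat;
  shift_linear : linear_functor shift;
  shift_equivalence : equivalence_functor shift;
  exact_triangle : forall X Y Z : tricat_rcat,
    hom X Y -> hom Y Z -> hom Z (shift X) -> Prop;
  tricat_iso_closed : tri_iso_closed exact_triangle;
  tricat_trivial : tri_trivial exact_triangle;
  tricat_cone : tri_cone exact_triangle;
  tricat_rotate : tri_rotate exact_triangle;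
  tricat_morphism : tri_morphism exact_triangle;
  tricat_octahedron : tri_octahedron exact_triangle
}.
Arguments shift {R} t.
Arguments exact_triangle {R t X Y Z} u v w : rename.

Definition full_subcat (R : comPzRingType) (A : rcat R) (P : A -> Prop) : rcat R :=
  @Rcat R {X : A | P X} (fun X Y => hom (sval X) (sval Y))
    (fun X => idm (sval X)) (fun X Y Z g f => g \c f)
    (fun X Y Z f => @comp_linl R A (sval X) (sval Y) (sval Z) f)
    (fun X Y Z g => @comp_linr R A (sval X) (sval Y) (sval Z) g)
    (fun X Y Z W h g f => compA h g f)
    (fun X Y f => comp1m f) (fun X Y f => compm1 f).

Record triexact (R : comPzRingType) := Triexact {
  ambient : tricat R;
  in_triexact : ambient -> Prop;
  triexact_zero : exists Z : ambient, is_zero Z /\ in_triexact Z;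
  triexact_ext : forall (X Y Z : ambient)
    (u : hom X Y) (v : hom Y Z) (w : hom Z (shift ambient X)),
    exact_triangle u v w -> in_triexact X -> in_triexact Z -> in_triexact Y
}.

Definition triexact_rcat (R : comPzRingType) (C : triexact R) : rcat R :=
  full_subcat (@in_triexact R C).
Coercion triexact_rcat : triexact >-> rcat.

Section TriExact.
Variables (R : comPzRingType) (C : triexact R).
Implicit Types X Y Z M : C.

Local Notation A := (ambient C).
Local Notation T := (shift A).

Definition Ext X Y : lmodType R := @hom R A (sval X) (T (sval Y)).

Definition ext_pre X X' Y (d : Ext X Y) (f : hom X' X) : Ext X' Y :=
  @comp R A (sval X') (sval X) (T (sval Y)) d f.

Definition ext_post X Y Y' (g : hom Y Y') (d : Ext X Y) : Ext X Y' :=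
  @comp R A (sval X) (T (sval Y)) (T (sval Y')) (fmor T g) d.

Definition ext_reflexive (I : lmodType R) : Prop :=
  forall X Y, reflexive_module I (Ext X Y).

Definition ext_injective X : Prop := forall M (d : Ext M X), d = 0.
Definition ext_projective X : Prop := forall M (d : Ext X M), d = 0.

Definition injectively_trivial X Y (f : hom X Y) : Prop :=
  forall M (d : Ext M X), ext_post f d = 0.

Definition projectively_trivial X Y (f : hom X Y) : Prop :=
  forall M (d : Ext Y M), ext_pre d f = 0.

Definition almost_split_sequence X Y Z (f : hom X Y) (g : hom Y Z) : Prop :=
  [/\ exists d : Ext Z X,
        @exact_triangle R A (sval X) (sval Y) (sval Z) f g d,
      left_minimal f /\ left_almost_split f
    & right_minimal g /\ right_almost_split g].

Definition has_ass_right : Prop :=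
  forall Z, strongly_indecomposable Z -> ~ ext_projective Z ->
    exists X Y (f : hom X Y) (g : hom Y Z), almost_split_sequence f g.

Definition has_ass_left : Prop :=
  forall X, strongly_indecomposable X -> ~ ext_injective X ->
    exists Y Z (f : hom X Y) (g : hom Y Z), almost_split_sequence f g.

Definition has_ass : Prop := has_ass_right /\ has_ass_left.
End TriExact.

Record ideal (R : comPzRingType) (C : rcat R) := Ideal {
  ideal_sub :> forall X Y : C, submodule (hom X Y);
  ideal_compl : forall (X Y Z : C) (g : hom Y Z) (f : hom X Y),
    f \in submod_mem (ideal_sub X Y) -> g \c f \in submod_mem (ideal_sub X Z);
  ideal_compr : forall (X Y Z : C) (g : hom Y Z) (f : hom X Y),
    g \in submod_mem (ideal_sub Y Z) -> g \c f \in submod_mem (ideal_sub X Z)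
}.

Section CompTheory.
Variables (R : comPzRingType) (C : rcat R) (X Y Z : C).

Lemma compDl (g g' : hom Y Z) (f : hom X Y) :
  (g + g') \c f = g \c f + g' \c f.
Proof. by have := comp_linl f 1 g g'; rewrite !scale1r. Qed.

Lemma compDr (g : hom Y Z) (f f' : hom X Y) :
  g \c (f + f') = g \c f + g \c f'.
Proof. by have := comp_linr g 1 f f'; rewrite !scale1r. Qed.

Lemma comp0m (f : hom X Y) : (0 : hom Y Z) \c f = 0.
Proof. by apply: (addIr (0 \c f)); rewrite -compDl !add0r. Qed.

Lemma compm0 (g : hom Y Z) : g \c (0 : hom X Y) = 0.
Proof. by apply: (addIr (g \c 0)); rewrite -compDr !add0r. Qed.

Lemma compNl (g : hom Y Z) (f : hom X Y) : (- g) \c f = - (g \c f).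
Proof. by apply: (addIr (g \c f)); rewrite -compDl !addNr comp0m. Qed.

Lemma compNr (g : hom Y Z) (f : hom X Y) : g \c (- f) = - (g \c f).
Proof. by apply: (addIr (g \c f)); rewrite -compDr !addNr compm0. Qed.

Lemma compBl (g g' : hom Y Z) (f : hom X Y) :
  (g - g') \c f = g \c f - g' \c f.
Proof. by rewrite compDl compNl. Qed.

Lemma compBr (g : hom Y Z) (f f' : hom X Y) :
  g \c (f - f') = g \c f - g \c f'.
Proof. by rewrite compDr compNr. Qed.

Lemma compZl a (g : hom Y Z) (f : hom X Y) : (a *: g) \c f = a *: (g \c f).
Proof. by have := comp_linl f a g 0; rewrite comp0m !addr0. Qed.

Lemma compZr a (g : hom Y Z) (f : hom X Y) : g \c (a *: f) = a *: (g \c f).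
Proof. by have := comp_linr g a f 0; rewrite compm0 !addr0. Qed.
End CompTheory.

Section QuotientCategory.
Variables (R : comPzRingType) (C : rcat R) (J : ideal C).

Definition quot_hom (X Y : C) : lmodType R := quot_mod (J X Y).

Definition proj_hom (X Y : C) (f : hom X Y) : quot_hom X Y :=
  quot_pi (J X Y) f.
Definition lift_hom (X Y : C) (f : quot_hom X Y) : hom X Y :=
  quot_repr (f : quot_mod (J X Y)).

Definition quot_comp (X Y Z : C) (g : quot_hom Y Z) (f : quot_hom X Y) :
  quot_hom X Z := proj_hom (lift_hom g \c lift_hom f).

Lemma lift_homK (X Y : C) (f : quot_hom X Y) : proj_hom (lift_hom f) = f.
Proof. exact: quot_reprK. Qed.

Lemma quot_comp_proj (X Y Z : C) (g : hom Y Z) (f : hom X Y) :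
  quot_comp (proj_hom g) (proj_hom f) = proj_hom (g \c f).
Proof.
apply/quot_piP.
set g' := lift_hom _; set f' := lift_hom _.
have -> : g' \c f' - g \c f = g' \c (f' - f) + (g' - g) \c f.
  by rewrite compBr compBl addrA subrK.
rewrite rpredD //; first exact/ideal_compl/quot_repr_pi.
exact/ideal_compr/quot_repr_pi.
Qed.

Lemma proj_hom_linear (X Y : C) : linear (@proj_hom X Y).
Proof. by move=> a f g; rewrite /proj_hom quot_piD -quot_scale_pi. Qed.

Lemma quot_comp_linl (X Y Z : C) (f : quot_hom X Y) :
  linear (fun g : quot_hom Y Z => quot_comp g f).
Proof.
move=> a g h; rewrite -[f]lift_homK -[g]lift_homK -[h]lift_homK.
by rewrite -proj_hom_linear !quot_comp_proj -proj_hom_linear comp_linl.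
Qed.

Lemma quot_comp_linr (X Y Z : C) (g : quot_hom Y Z) :
  linear (fun f : quot_hom X Y => quot_comp g f).
Proof.
move=> a f h; rewrite -[f]lift_homK -[g]lift_homK -[h]lift_homK.
by rewrite -proj_hom_linear !quot_comp_proj -proj_hom_linear comp_linr.
Qed.

Lemma quot_compA (X Y Z W : C)
    (h : quot_hom Z W) (g : quot_hom Y Z) (f : quot_hom X Y) :
  quot_comp h (quot_comp g f) = quot_comp (quot_comp h g) f.
Proof.
rewrite -[f]lift_homK -[g]lift_homK -[h]lift_homK.
by rewrite !quot_comp_proj compA.
Qed.

Lemma quot_comp1m (X Y : C) (f : quot_hom X Y) :
  quot_comp (proj_hom (idm Y)) f = f.
Proof. by rewrite -[f]lift_homK quot_comp_proj comp1m. Qed.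

Lemma quot_compm1 (X Y : C) (f : quot_hom X Y) :
  quot_comp f (proj_hom (idm X)) = f.
Proof. by rewrite -[f]lift_homK quot_comp_proj compm1. Qed.

Definition quot_cat : rcat R :=
  @Rcat R C quot_hom (fun X => proj_hom (idm X)) quot_comp
    quot_comp_linl quot_comp_linr quot_compA quot_comp1m quot_compm1.
End QuotientCategory.

Section StableCategories.
Variables (R : comPzRingType) (C : triexact R).
Implicit Types X Y Z M : C.

Lemma ext_post_linl X Y M (d : Ext M X) :
  linear (fun f : hom X Y => ext_post f d).
Proof.
by move=> a f g; rewrite /ext_post (@shift_linear R (ambient C)) comp_linl.
Qed.

Lemma ext_pre_linr X Y M (d : Ext Y M) :
  linear (fun f : hom X Y => ext_pre d f).
Proof. by move=> a f g; rewrite /ext_pre comp_linr. Qed.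

Lemma ext_post_comp X Y Z M (g : hom Y Z) (f : hom X Y) (d : Ext M X) :
  ext_post (g \c f) d = ext_post g (ext_post f d).
Proof. by rewrite /ext_post fmor_comp compA. Qed.

Lemma ext_pre_comp X Y Z M (d : Ext Z M) (g : hom Y Z) (f : hom X Y) :
  ext_pre d (g \c f) = ext_pre (ext_pre d g) f.
Proof. by rewrite /ext_pre compA. Qed.

Definition injt_pred X Y : {pred hom X Y} :=
  fun f => `[< injectively_trivial f >].
Definition projt_pred X Y : {pred hom X Y} :=
  fun f => `[< projectively_trivial f >].

Lemma injt_closed X Y : submod_closed (@injt_pred X Y).
Proof.
split=> [|a f g /asboolP Jf /asboolP Jg]; apply/asboolP => M d.
  have := ext_post_linl d (-1) (0 : hom X Y) 0.
  by rewrite scaler0 addr0 scaleN1r addNr.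
by rewrite ext_post_linl Jf Jg scaler0 addr0.
Qed.

Lemma projt_closed X Y : submod_closed (@projt_pred X Y).
Proof.
split=> [|a f g /asboolP Jf /asboolP Jg]; apply/asboolP => M d.
  exact: compm0.
by rewrite ext_pre_linr Jf Jg scaler0 addr0.
Qed.

Lemma ext_post0 X Y M (f : hom X Y) : ext_post f (0 : Ext M X) = 0.
Proof. exact: compm0. Qed.

Lemma ext_pre0 X Y M (f : hom X Y) : ext_pre (0 : Ext Y M) f = 0.
Proof. exact: comp0m. Qed.

Lemma injt_compl X Y Z (g : hom Y Z) (f : hom X Y) :
  f \in @injt_pred X Y -> g \c f \in @injt_pred X Z.
Proof.
by move=> /asboolP Jf; apply/asboolP => M d; rewrite ext_post_comp Jf ext_post0.
Qed.

Lemma injt_compr X Y Z (g : hom Y Z) (f : hom X Y) :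
  g \in @injt_pred Y Z -> g \c f \in @injt_pred X Z.
Proof. by move=> /asboolP Jg; apply/asboolP => M d; rewrite ext_post_comp Jg. Qed.

Lemma projt_compl X Y Z (g : hom Y Z) (f : hom X Y) :
  f \in @projt_pred X Y -> g \c f \in @projt_pred X Z.
Proof. by move=> /asboolP Jf; apply/asboolP => M d; rewrite ext_pre_comp Jf. Qed.

Lemma projt_compr X Y Z (g : hom Y Z) (f : hom X Y) :
  g \in @projt_pred Y Z -> g \c f \in @projt_pred X Z.
Proof.
by move=> /asboolP Jg; apply/asboolP => M d; rewrite ext_pre_comp Jg ext_pre0.
Qed.

Definition injt_ideal : ideal C :=
  @Ideal R C (fun X Y => Submodule (@injt_closed X Y)) injt_compl injt_compr.
Definition projt_ideal : ideal C :=
  @Ideal R C (fun X Y => Submodule (@projt_closed X Y)) projt_compl projt_compr.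

Definition over_cat : rcat R := quot_cat injt_ideal.
Definition under_cat : rcat R := quot_cat projt_ideal.

(* The actions of stable morphisms on Ext go through chosen representatives;
   ext_under_proj and ext_over_proj show that any representative will do. *)
Definition ext_under X X' Y (d : Ext X Y) (f : @hom R under_cat X' X) :
  Ext X' Y := ext_pre d (lift_hom f).
Definition ext_over X Y Y' (g : @hom R over_cat Y Y') (d : Ext X Y) :
  Ext X Y' := ext_post (lift_hom g) d.

Lemma ext_under_proj X X' Y (d : Ext X Y) (f : hom X' X) :
  ext_under d (proj_hom projt_ideal f) = ext_pre d f.
Proof.
have /asboolP/(_ _ d) := quot_repr_pi (projt_ideal X' X) f.
by rewrite /ext_pre compBr => /eqP; rewrite subr_eq0 => /eqP.
Qed.

Lemma ext_over_proj X Y Y' (g : hom Y Y') (d : Ext X Y) :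
  ext_over (proj_hom injt_ideal g) d = ext_post g d.
Proof.
have /asboolP/(_ _ d) E := quot_repr_pi (injt_ideal Y Y') g.
have := ext_post_linl d 1 (quot_repr (quot_pi (injt_ideal Y Y') g) - g) g.
by rewrite !scale1r subrK E add0r.
Qed.

Section ARFunctors.
Variable I : lmodType R.

(* tau is not assumed R-linear: linearity on morphisms follows from the
   linearity, bijectivity and naturality of Phi, since dual I separates the
   elements of Ext.  The same holds for left_AR_functor. *)
Definition right_AR_functor (tau : functor under_cat over_cat) : Prop :=
  exists Phi : forall X Y : C,
      {linear @hom R under_cat X Y -> dual I (Ext Y (tau X))},
    (forall X Y, bijective (Phi X Y)) /\
    (forall (X X' Y Y' : C) (a : @hom R under_cat X' X)
        (b : @hom R under_cat Y Y') (x : @hom R under_cat X Y)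
        (d : Ext Y' (tau X')),
      evalD d (Phi X' Y' (b \c x \c a)) =
      evalD (ext_over (fmor tau a) (ext_under d b)) (Phi X Y x)).

Definition left_AR_functor (tau : functor over_cat under_cat) : Prop :=
  exists Psi : forall X Y : C,
      {linear @hom R over_cat X Y -> dual I (Ext (tau Y) X)},
    (forall X Y, bijective (Psi X Y)) /\
    (forall (X X' Y Y' : C) (a : @hom R over_cat X' X)
        (b : @hom R over_cat Y Y') (x : @hom R over_cat X Y)
        (d : Ext (tau Y') X'),
      evalD d (Psi X' Y' (b \c x \c a)) =
      evalD (ext_over a (ext_under d (fmor tau b))) (Psi X Y x)).

Definition right_AR_equivalence (tau : functor under_cat over_cat) : Prop :=
  right_AR_functor tau /\ equivalence_functor tau.

Definition left_AR_equivalence (tau : functor over_cat under_cat) : Prop :=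
  left_AR_functor tau /\ equivalence_functor tau.
End ARFunctors.
End StableCategories.

(* Main.v *)
(* Call a linear form theta on Ext(Z, X) a Serre pairing if h |-> theta(- h)
   identifies the stable Hom(Z, L) with D Ext(L, X) and v |-> theta(v -)
   identifies the costable Hom(M, X) with D Ext(Z, M), for all L and M.  The
   class d in Ext(Z, X) of an almost split sequence is a multiple of every
   non-zero class of Ext(L, X) and of Ext(Z, M), so any theta with
   theta(d) <> 0 is non-degenerate on both sides, and reflexivity of Hom makes
   it a Serre pairing; these pairings add up along Krull-Schmidt
   decompositions.  Conversely, a linear form on End(Z) killing the radical but
   not the identity is of the form h |-> theta(d h), by reflexivity, and d is
   then the class of an almost split sequence.  An Auslander-Reiten functor is
   a coherent choice of half of a Serre pairing for every Z, and Serre pairings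
   determine both partners uniquely up to stable isomorphism, whence the
   equivalences.  Left-hand statements follow from the right-hand ones by
   passing to opposite categories: Ext enters only as a bimodule over a pair of
   categories, which makes the argument self-dual without opposite
   triangulated structures. *)
From HB Require Import structures.
From mathcomp Require Import all_boot all_algebra.
From mathcomp Require Import boolp.
Require Import Defs.

Set Implicit Arguments.
Unset Strict Implicit.
Unset Printing Implicit Defensive.

Import GRing.Theory.
Local Open Scope ring_scope.

(** * Linear forms with values in a co-generator, and pairings with a reflexive module *)

Section LinearForms.
Variables (R : comPzRingType) (I : lmodType R).
Implicit Types U V : lmodType R.

Lemma linear_map0 U V (f : U -> V) : linear f -> f 0 = 0.
Proof.
by move=> lf; have := lf (-1) 0 0; rewrite scaler0 addr0 scaleN1r addNr.
Qed.

Lemma linear_mapD U V (f : U -> V) : linear f -> {morph f : x y / x + y}.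
Proof. by move=> lf x y; rewrite -[x in LHS]scale1r lf scale1r. Qed.

Lemma linear_mapB U V (f : U -> V) : linear f -> {morph f : x y / x - y}.
Proof. by move=> lf x y; rewrite -scaleN1r addrC lf scaleN1r addrC. Qed.

Lemma linear_map_sum U V (f : U -> V) n (x : 'I_n -> U) :
  linear f -> f (\sum_(k < n) x k) = \sum_(k < n) f (x k).
Proof.
by move=> lf; apply: (big_morph f (linear_mapD lf)); apply: linear_map0.
Qed.

Definition lin_map U V (f : U -> V) (lf : linear f) : {linear U -> V} :=
  HB.pack_for {linear U -> V} f (GRing.isLinear.Build R U V *:%R f lf).

Definition lin_form U (f : U -> I) (lf : linear f) : dual I U := lin_map lf.

Lemma lin_formE U (f : U -> I) (lf : linear f) x :
  evalD x (lin_form lf) = f x.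
Proof. by []. Qed.

Lemma dual_ext U (f g : dual I U) : (forall x, evalD x f = evalD x g) -> f = g.
Proof. exact: lin_hom_ext. Qed.

Lemma evalD_lin U (f : dual I U) : linear (fun x => evalD x f).
Proof. by move=> a x y; apply: (@linearP _ _ _ _ (f : {linear U -> I})). Qed.

Lemma inj_surj_bijective (S T : Type) (f : S -> T) :
  injective f -> (forall y, exists x, f x = y) -> bijective f.
Proof.
move=> fI /choice[g fK]; exists g => [x|y]; last exact: fK.
exact/fI/fK.
Qed.

Hypothesis cogI : cogenerator I.

Lemma separating_form U (x : U) : x <> 0 -> exists f : dual I U, evalD x f <> 0.
Proof. by move=> /eqP/cogI[f /eqP fx]; exists f. Qed.

Lemma quot_pi_linear U (S : submodule U) : linear (quot_pi S).
Proof. by move=> a x y; rewrite quot_piD -quot_scale_pi. Qed.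

Lemma separating_form_mod U (S : submodule U) x : x \notin submod_mem S ->
  exists f : dual I U,
    (forall y, y \in submod_mem S -> evalD y f = 0) /\ evalD x f <> 0.
Proof.
have pi0 y : quot_pi S y = 0 <-> y \in submod_mem S.
  rewrite -(linear_map0 (@quot_pi_linear U S)).
  by split=> [/quot_piP|Sy]; [|apply/quot_piP]; rewrite subr0.
move=> Sx; have [|f fx] := @separating_form (quot_mod S) (quot_pi S x).
  by move=> /pi0; rewrite (negPf Sx).
have lf : linear (fun y => evalD (quot_pi S y) f).
  by move=> a y z; rewrite quot_pi_linear evalD_lin.
exists (lin_form lf); split=> // y /pi0 y0.
by rewrite lin_formE y0 (linear_map0 (evalD_lin f)).
Qed.

Section Pairing.
Variables (U V : lmodType R) (b : U -> V -> I).
Hypothesis b_linl : forall v, linear (b^~ v).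
Hypothesis b_linr : forall u, linear (b u).
Hypothesis reflU : reflexive_module I U.

(** Non-degeneracy embeds [V] in the dual of [U]. Injectivity of [I] extends [phi] to a form on that
    dual, which by reflexivity of [U] is evaluation at some [u]. *)
Lemma pairing_form_left (phi : dual I V) : injective_module I ->
  (forall v, (forall u, b u v = 0) -> v = 0) ->
  exists u, forall v, evalD v phi = b u v.
Proof.
move=> injI b_nd; have lbv : linear (fun v => lin_form (b_linl v)).
  by move=> a v w; apply: dual_ext => u; apply: b_linr.
pose bv := lin_map lbv.
have bv_inj : injective bv.
  move=> v w bvw; apply/eqP; rewrite -subr_eq0; apply/eqP/b_nd => u.
  rewrite (linear_mapB (b_linr u)) -[b u v]/(evalD u (bv v)) bvw.
  exact: subrr.
have [psi psiE] := injI _ _ bv phi bv_inj.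
case: reflU => eta _ /(_ (psi : dual I (dual I U))) etaK.
exists (eta psi) => v.
rewrite -[LHS]psiE -[b _ v]/(evalD (bv v) (bidual I (eta psi))).
by rewrite etaK.
Qed.

(** If [phi] were outside the submodule of forms [b - v], the co-generator would give a form on the
    dual of [U] killing that submodule but not [phi]. By reflexivity it is evaluation at some [u] in
    the left kernel of [b], where [phi] vanishes. *)
Lemma pairing_form_right (phi : dual I U) :
  (forall u, (forall v, b u v = 0) -> evalD u phi = 0) ->
  exists v, forall u, evalD u phi = b u v.
Proof.
move=> phi0; pose bv v : dual I U := lin_form (b_linl v).
have S_closed : submod_closed (fun f : dual I U => `[< exists v, f = bv v >]).
  split=> [|a f g /asboolP[v ->] /asboolP[w ->]]; apply/asboolP.
    exists 0; apply: dual_ext => u.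
    by rewrite lin_formE (linear_map0 (b_linr u)).
  exists (a *: v + w); apply: dual_ext => u.
  by rewrite lin_formE b_linr.
have [/asboolP[v ->]|Sphi] := boolP (phi \in submod_mem (Submodule S_closed)).
  by exists v.
have [f [f0 fphi]] := separating_form_mod Sphi.
case: reflU => eta _ /(_ (f : dual I (dual I U))) etaK; case: fphi.
rewrite -[X in evalD _ X]etaK; apply: phi0 => v.
have : evalD (bv v) f = 0 by apply: f0; apply/asboolP; exists v.
by rewrite -[X in evalD _ X]etaK.
Qed.

(** An element of the bidual of [V], pulled back along [u |-> b u -], is a form on [U] killing the
    left kernel, hence some [b - v]. As the forms [b u -] exhaust the dual of [V], the element is
    evaluation at [v]. *)
Lemma pairing_reflexive :
  (forall phi : dual I V, exists u, forall v, evalD v phi = b u v) ->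
  reflexive_module I V.
Proof.
move=> b_onto; apply: inj_surj_bijective => [v w vw|psi].
  apply: contrapT => /eqP; rewrite -subr_eq0 => /eqP/separating_form[f []].
  rewrite (linear_mapB (evalD_lin f)) -[evalD v f]/(evalD f (bidual I v)) vw.
  exact: subrr.
pose bu u : dual I V := lin_form (b_linr u).
have lphi : linear (fun u => evalD (bu u) psi).
  move=> a u w; rewrite -evalD_lin; congr evalD.
  by apply: dual_ext => v; apply: b_linl.
have [u bu0|v vE] := @pairing_form_right (lin_form lphi).
  rewrite lin_formE (_ : bu u = 0) ?(linear_map0 (evalD_lin psi)) //.
  exact: dual_ext.
exists v; apply: dual_ext => f; have [u uE] := b_onto f.
have -> : f = bu u by apply: dual_ext => w; rewrite uE.
exact/esym/vE.
Qed.
End Pairing.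
End LinearForms.

(** * Sections, retractions, local endomorphism rings and Krull-Schmidt decompositions *)

Section Category.
Variables (R : comPzRingType) (C : rcat R).
Implicit Types X Y Z M : C.

Lemma comp_suml n X Y Z (g : 'I_n -> hom Y Z) (f : hom X Y) :
  (\sum_(k < n) g k) \c f = \sum_(k < n) g k \c f.
Proof. exact: (linear_map_sum _ (comp_linl f)). Qed.

Lemma comp_sumr n X Y Z (g : hom Y Z) (f : 'I_n -> hom X Y) :
  g \c (\sum_(k < n) f k) = \sum_(k < n) g \c f k.
Proof. exact: (linear_map_sum _ (comp_linr g)). Qed.

Lemma is_zero_idm X : is_zero X <-> idm X = 0.
Proof.
split=> [/(_ X)[X0 _]|X0 M]; first exact: X0.
split=> f.
  by rewrite -[f]compm1 X0 compm0.
by rewrite -[f]comp1m X0 comp0m.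
Qed.

Lemma is_iso_idm X : is_iso (idm X).
Proof. by exists (idm X); rewrite comp1m. Qed.

Lemma not_iso_comp_retraction X Y (r : hom X Y) (h : hom Y X) :
  ~ is_retraction r -> ~ is_iso (r \c h).
Proof. by move=> nr [s [_ E]]; apply: nr; exists (h \c s); rewrite compA. Qed.

Lemma not_iso_comp_section X Y (s : hom X Y) (h : hom Y X) :
  ~ is_section s -> ~ is_iso (h \c s).
Proof. by move=> ns [r [E _]]; apply: ns; exists (r \c h); rewrite -compA. Qed.

(* Jacobson's identity: [1 + f (1 - g f)^-1 g] is inverse to [1 - f g]. *)
Lemma is_iso_1B X Y (g : hom X Y) (f : hom Y X) :
  is_iso (idm Y - g \c f) -> is_iso (idm X - f \c g).
Proof.
move=> [s [sE Es]]; exists (idm X + f \c s \c g); split.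
  rewrite compBr compm1 compDl comp1m.
  have -> : f \c s \c g \c (f \c g) = f \c (s \c (g \c f)) \c g.
    by rewrite !compA.
  have -> : s \c (g \c f) = s - idm Y by rewrite -sE compBr compm1 subKr.
  by rewrite compBr compm1 compBl [X in _ - X]addrC subrK addrK.
rewrite compBl comp1m compDr compm1.
have -> : f \c g \c (f \c s \c g) = f \c ((g \c f) \c s) \c g.
  by rewrite !compA.
have -> : g \c f \c s = s - idm Y by rewrite -Es compBl comp1m subKr.
by rewrite compBr compm1 compBl [X in _ - X]addrC subrK addrK.
Qed.

Section StronglyIndecomposable.
Variable X : C.
Hypothesis siX : strongly_indecomposable X.

Lemma strong_indec_not_iso0 : ~ is_iso (0 : hom X X).
Proof. by case: siX => X0 _ [g [g0 _]]; apply: X0; rewrite -g0 compm0. Qed.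

Lemma strong_indec_not_iso_sum n (f : 'I_n -> hom X X) :
  (forall k, ~ is_iso (f k)) -> ~ is_iso (\sum_(k < n) f k).
Proof.
move=> nf; apply: (big_ind (fun g => ~ is_iso g)) => //.
- exact: strong_indec_not_iso0.
- by case: siX.
Qed.

Lemma strong_indec_iso_1B (f : hom X X) : ~ is_iso f -> is_iso (idm X - f).
Proof.
move=> nf; apply: contrapT => n1f; case: siX => _ /(_ _ _ nf n1f).
by rewrite addrC subrK; apply; apply: is_iso_idm.
Qed.
End StronglyIndecomposable.

Lemma krull_schmidt_decomposition X : krull_schmidt C ->
  exists n (Y : 'I_n -> C),
    (forall k, strongly_indecomposable (Y k)) /\ is_direct_sum Y X.
Proof.
move=> ksC; have [X0|/ksC//] := pselect (is_zero X).
(* A zero object is the empty sum; the family is a dummy on the empty index type. *)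
exists 0, (fun=> X); split=> [[]//|].
exists (fun=> 0), (fun=> 0); split=> [[]//|[]//|].
by rewrite big_ord0; apply/esym/is_zero_idm.
Qed.

Lemma additive_zero X : additive_rcat C -> exists O : C, idm O = 0.
Proof.
move=> /(_ 0 (fun=> X))[O [i [p [_ _ E]]]].
by exists O; rewrite -E big_ord0.
Qed.
End Category.

(** * Passage to opposite categories *)

Section Opposite.
Variable R : comPzRingType.

Definition op_rcat (C : rcat R) : rcat R :=
  @Rcat R C (fun X Y => hom Y X) (fun X => idm X) (fun X Y Z g f => f \c g)
    (fun X Y Z f => @comp_linr R C Z Y X f)
    (fun X Y Z g => @comp_linl R C Z Y X g)
    (fun X Y Z W h g f => esym (compA f g h))
    (fun X Y f => compm1 f) (fun X Y f => comp1m f).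

Variable C : rcat R.

Lemma is_iso_op (X Y : C) (f : hom X Y) :
  @is_iso R (op_rcat C) Y X f <-> is_iso f.
Proof. by split=> -[g [? ?]]; exists g. Qed.

Lemma strongly_indecomposable_op (X : C) :
  @strongly_indecomposable R (op_rcat C) X <-> strongly_indecomposable X.
Proof.
split=> -[X0 H]; split=> // f g nf ng.
  by move=> /is_iso_op; apply: H => /is_iso_op.
by move=> /is_iso_op; apply: H => /is_iso_op.
Qed.

Lemma is_direct_sum_op n (Y : 'I_n -> C) (X : C) :
  is_direct_sum Y X -> @is_direct_sum R (op_rcat C) n Y X.
Proof.
move=> [i [p [pi1 pi0 ip]]]; exists p, i; split=> // j k jk.
by apply: pi0; rewrite eq_sym.
Qed.

Lemma krull_schmidt_op : krull_schmidt C -> krull_schmidt (op_rcat C).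
Proof.
move=> ksC X X0; have [|n [Y [Ysi YX]]] := ksC X.
  by move=> Xz; apply: X0 => M; case: (Xz M).
exists n, Y; split=> [k|]; first exact/strongly_indecomposable_op.
exact: is_direct_sum_op.
Qed.

Lemma additive_op : additive_rcat C -> additive_rcat (op_rcat C).
Proof.
by move=> addC n Y; case: (addC n Y) => X XY; exists X; apply: is_direct_sum_op.
Qed.

Lemma hom_reflexive_op (I : lmodType R) :
  hom_reflexive C I -> hom_reflexive (op_rcat C) I.
Proof. by move=> hC X Y; apply: hC. Qed.
End Opposite.

(** * Equivalences as full, faithful and essentially surjective functors *)

Section Equivalence.
Variables (R : comPzRingType) (C D : rcat R).
Implicit Types F : functor C D.

Definition faithful_functor F : Prop :=
  forall (X Y : C) (f g : hom X Y), fmor F f = fmor F g -> f = g.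

Definition essentially_surjective F : Prop :=
  forall Y : D, exists (X : C) (f : hom (F X) Y), is_iso f.

Lemma nat_iso_id_faithful (F : functor C D) (G : functor D C) :
  naturally_isomorphic (functor_comp G F) (functor_id C) -> faithful_functor F.
Proof.
move=> [eta [etaI etaN]] X Y f g fg; have [e [_ eta_e]] := etaI X.
rewrite -[f]compm1 -[g]compm1 -eta_e !compA.
rewrite -[f]/(fmor (functor_id C) f) -[g]/(fmor (functor_id C) g).
by rewrite -!etaN /= fg.
Qed.
End Equivalence.

Lemma equivalence_fully_faithful (R : comPzRingType) (C D : rcat R)
    (F : functor C D) : equivalence_functor F ->
  [/\ full_functor F, faithful_functor F & essentially_surjective F].
Proof.
case=> G [GF FG]; split; last 2 first.
- exact: nat_iso_id_faithful GF.
- by case: FG => eps [epsI _] Y; exists (G Y), (eps Y); apply: epsI.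
move=> X Y g; have Gf := nat_iso_id_faithful FG.
case: GF => eta [etaI etaN].
have [x [xeta etax]] := etaI X; have [y [yeta etay]] := etaI Y.
(* Naturality of [eta] forces this preimage. It is compared with [g] after applying [G], which is
   faithful because [F] after [G] is isomorphic to the identity. *)
exists (eta Y \c fmor G g \c x); apply: Gf.
have := etaN _ _ (eta Y \c fmor G g \c x); rewrite /= -[RHS]compA xeta compm1.
by move=> /(congr1 (comp y)); rewrite !compA yeta !comp1m.
Qed.

(** The quasi-inverse chooses preimages of objects and, after conjugation by the chosen
    isomorphisms, of morphisms; faithfulness makes these choices functorial. *)
Lemma fully_faithful_equivalence (R : comPzRingType) (C D : rcat R)
    (F : functor C D) :
  full_functor F -> faithful_functor F -> essentially_surjective F ->
  equivalence_functor F.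
Proof.
move=> Ffull Ffaith /choice[G0 HG].
pose e Y := sval (cid (HG Y)); have eI Y : is_iso (e Y) := svalP (cid (HG Y)).
pose d Y := sval (cid (eI Y)).
have [de ed] : (forall Y, d Y \c e Y = idm _) /\ (forall Y, e Y \c d Y = idm _).
  by split=> Y; case: (svalP (cid (eI Y))).
pose G1 (X Y : D) (f : hom X Y) := sval (cid (Ffull _ _ (d Y \c f \c e X))).
have FG1 X Y (f : hom X Y) : fmor F (G1 X Y f) = d Y \c f \c e X.
  by rewrite /G1; case: cid.
have G1_id X : G1 _ _ (idm X) = idm _.
  by apply: Ffaith; rewrite FG1 compm1 de fmor_id.
have G1_comp X Y Z (g : hom Y Z) (f : hom X Y) :
    G1 _ _ (g \c f) = G1 _ _ g \c G1 _ _ f.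
  apply: Ffaith; rewrite fmor_comp !FG1 !compA; congr (_ \c _).
  by rewrite -!compA (compA (e Y)) ed comp1m.
exists (@Functor R D C G0 G1 G1_id G1_comp); split; last first.
  exists e; split=> // X Y f /=.
  by rewrite FG1 !compA ed comp1m.
pose h X := sval (cid (Ffull _ _ (e (F X)))).
pose k X := sval (cid (Ffull _ _ (d (F X)))).
have Fh X : fmor F (h X) = e (F X) by rewrite /h; case: cid.
have Fk X : fmor F (k X) = d (F X) by rewrite /k; case: cid.
exists h; split=> [X|X Y f] /=.
  exists (k X); split; apply: Ffaith; rewrite fmor_comp Fh Fk fmor_id //.
apply: Ffaith; rewrite !fmor_comp !Fh FG1 !compA ed comp1m //.
Qed.

(** * Bimodules over a pair of categories *)

Record bimod (R : comPzRingType) (P Q : rcat R) := Bimod {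
  bim :> P -> Q -> lmodType R;
  pre : forall X X' Y, bim X Y -> hom X' X -> bim X' Y;
  post : forall X Y Y', hom Y Y' -> bim X Y -> bim X Y';
  pre_linl : forall X X' Y (f : hom X' X), linear (fun d : bim X Y => pre d f);
  pre_linr : forall X X' Y (d : bim X Y), linear (fun f : hom X' X => pre d f);
  post_linl : forall X Y Y' (d : bim X Y),
    linear (fun g : hom Y Y' => post g d);
  post_linr : forall X Y Y' (g : hom Y Y'), linear (@post X Y Y' g);
  pre1 : forall X Y (d : bim X Y), pre d (idm X) = d;
  post1 : forall X Y (d : bim X Y), post (idm Y) d = d;
  pre_comp : forall X X' X'' Y (d : bim X Y) (f : hom X' X) (g : hom X'' X'),
    pre d (f \c g) = pre (pre d f) g;
  post_comp : forall X Y Y' Y'' (g : hom Y' Y'') (f : hom Y Y') (d : bim X Y),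
    post (g \c f) d = post g (post f d);
  pre_post : forall X X' Y Y' (g : hom Y Y') (d : bim X Y) (f : hom X' X),
    pre (post g d) f = post g (pre d f)
}.
Arguments pre {R P Q b X X' Y} d f.
Arguments post {R P Q b X Y Y'} g d.

(** The variables are exchanged, so [pre_represents] for this bimodule is, by conversion,
    [post_represents] for [B]. *)
Definition op_bimod (R : comPzRingType) (P Q : rcat R) (B : bimod P Q) :
    bimod (op_rcat Q) (op_rcat P) :=
  @Bimod R (op_rcat Q) (op_rcat P) (fun Y X => B X Y)
    (fun (Y Y' : Q) (X : P) (d : B X Y) (f : hom Y Y') => post f d)
    (fun (Y : Q) (X X' : P) (g : hom X' X) (d : B X Y) => pre d g)
    (fun Y Y' X f => @post_linr R P Q B X Y Y' f)
    (fun Y Y' X d => @post_linl R P Q B X Y Y' d)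
    (fun Y X X' d => @pre_linr R P Q B X X' Y d)
    (fun Y X X' g => @pre_linl R P Q B X X' Y g)
    (fun Y X d => post1 d) (fun Y X d => pre1 d)
    (fun (Y Y' Y'' : Q) (X : P) (d : B X Y) (f : hom Y Y')
       (g : hom Y' Y'') => post_comp g f d)
    (fun (Y : Q) (X X' X'' : P) (g : hom X'' X') (f : hom X' X)
       (d : B X Y) => pre_comp d f g)
    (fun (Y Y' : Q) (X X' : P) (g : hom X' X) (d : B X Y) (f : hom Y Y') =>
       esym (pre_post f d g)).

Section Bimodule.
Variables (R : comPzRingType) (P Q : rcat R) (B : bimod P Q).

Lemma pre0 (X X' : P) (Y : Q) (f : hom X' X) : pre (0 : B X Y) f = 0.
Proof. exact: (linear_map0 (@pre_linl R P Q B X X' Y f)). Qed.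

Lemma prem0 (X X' : P) (Y : Q) (d : B X Y) : pre d (0 : hom X' X) = 0.
Proof. exact: (linear_map0 (@pre_linr R P Q B X X' Y d)). Qed.

Lemma post0 (X : P) (Y Y' : Q) (g : hom Y Y') : post g (0 : B X Y) = 0.
Proof. exact: (linear_map0 (@post_linr R P Q B X Y Y' g)). Qed.

Lemma post0m (X : P) (Y Y' : Q) (d : B X Y) : post (0 : hom Y Y') d = 0.
Proof. exact: (linear_map0 (@post_linl R P Q B X Y Y' d)). Qed.

Lemma preBr (X X' : P) (Y : Q) (d : B X Y) (f g : hom X' X) :
  pre d (f - g) = pre d f - pre d g.
Proof. exact: (linear_mapB (@pre_linr R P Q B X X' Y d)). Qed.

Lemma postBl (X : P) (Y Y' : Q) (d : B X Y) (f g : hom Y Y') :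
  post (f - g) d = post f d - post g d.
Proof. exact: (linear_mapB (@post_linl R P Q B X Y Y' d)). Qed.

Lemma pre_sumr n (X X' : P) (Y : Q) (d : B X Y) (f : 'I_n -> hom X' X) :
  pre d (\sum_(k < n) f k) = \sum_(k < n) pre d (f k).
Proof. exact: (linear_map_sum _ (@pre_linr R P Q B X X' Y d)). Qed.

Lemma post_suml n (X : P) (Y Y' : Q) (d : B X Y) (f : 'I_n -> hom Y Y') :
  post (\sum_(k < n) f k) d = \sum_(k < n) post (f k) d.
Proof. exact: (linear_map_sum _ (@post_linl R P Q B X Y Y' d)). Qed.
End Bimodule.

(** * Forms that represent the duals of a bimodule *)

Section Representation.
Variables (R : comPzRingType) (I : lmodType R) (P Q : rcat R) (B : bimod P Q).

(* [h |-> theta (- h)] induces isomorphisms from [hom Z L], modulo the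
   morphisms acting trivially on [B], onto the dual of [B L X]. *)
Definition pre_represents (Z : P) (X : Q) (theta : dual I (B Z X)) : Prop :=
  (forall (L : P) (h : hom Z L),
     (forall d : B L X, evalD (pre d h) theta = 0) ->
     forall (M : Q) (d : B L M), pre d h = 0) /\
  (forall (L : P) (phi : dual I (B L X)),
     exists h : hom Z L, forall d, evalD d phi = evalD (pre d h) theta).

Definition post_represents (Z : P) (X : Q) (theta : dual I (B Z X)) : Prop :=
  (forall (M : Q) (v : hom M X),
     (forall d : B Z M, evalD (post v d) theta = 0) ->
     forall (L : P) (d : B L M), post v d = 0) /\
  (forall (M : Q) (phi : dual I (B Z M)),
     exists v : hom M X, forall d, evalD d phi = evalD (post v d) theta).

Definition serre_pair (Z : P) (X : Q) (theta : dual I (B Z X)) : Prop :=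
  pre_represents theta /\ post_represents theta.

Lemma pre_form_linear (Z L : P) (X : Q) (h : hom Z L) (theta : dual I (B Z X)) :
  linear (fun d : B L X => evalD (pre d h) theta).
Proof. by move=> a d e; rewrite pre_linl evalD_lin. Qed.

Lemma post_form_linear (Z : P) (M X : Q) (v : hom M X)
    (theta : dual I (B Z X)) :
  linear (fun d : B Z M => evalD (post v d) theta).
Proof. by move=> a d e; rewrite post_linr evalD_lin. Qed.

Lemma pre_form_linear_hom (Z L : P) (X : Q) (d : B L X)
    (theta : dual I (B Z X)) :
  linear (fun h : hom Z L => evalD (pre d h) theta).
Proof. by move=> a h k; rewrite pre_linr evalD_lin. Qed.

(** A non-zero [d] is detected by some form, and every form on [B L X] is [theta (- h)] for some
    [h]. *)
Lemma pre_represents_separates (Z : P) (X : Q) (theta : dual I (B Z X))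
    (L : P) (d : B L X) :
  cogenerator I -> pre_represents theta ->
  (forall h : hom Z L, evalD (pre d h) theta = 0) -> d = 0.
Proof.
move=> cogI [_ onto] d0; apply: contrapT => /(separating_form cogI)[phi []].
by have [h ->] := onto _ phi.
Qed.

(** The pairing of [hom Z L] with [B L X] attains all forms on [B L X], so [pairing_reflexive]
    applies. This is the source of Ext-reflexivity. *)
Lemma pre_represents_reflexive (Z : P) (X : Q) (theta : dual I (B Z X))
    (L : P) :
  cogenerator I -> pre_represents theta -> reflexive_module I (hom Z L) ->
  reflexive_module I (B L X).
Proof.
move=> cogI [_ onto] reflU.
apply: (@pairing_reflexive _ _ cogI _ _
          (fun h d => evalD (pre d h) theta)) => //.
- by move=> d; apply: pre_form_linear_hom.
- by move=> h; apply: pre_form_linear.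
Qed.
End Representation.

Section Serre.
Variables (R : comPzRingType) (I : lmodType R) (P Q : rcat R) (B : bimod P Q).

(** This transfer of endomorphisms is what [almost_zero_exists] requires besides
    [pre_represents]. *)
Lemma pre_represents_endo (Z : P) (X : Q) (theta : dual I (B Z X)) :
  pre_represents theta -> forall b : hom X X, exists a : hom Z Z,
    forall d, evalD (post b d) theta = evalD (pre d a) theta.
Proof.
move=> [_ onto] b; have [a aE] := onto _ (lin_form (post_form_linear b theta)).
by exists a.
Qed.

(** The pairing is transported along the inverse [g] of [f], as [theta (g -)]. *)
Lemma serre_pair_iso (Z : P) (X X' : Q) (theta : dual I (B Z X))
    (f : hom X X') :
  is_iso f -> serre_pair theta ->
  exists theta' : dual I (B Z X'), serre_pair theta'.
Proof.
move=> [g [gf fg]] [[zP oP] [zQ oQ]].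
have postK L (d : B L X') : post f (post g d) = d.
  by rewrite -post_comp fg post1.
exists (lin_form (post_form_linear g theta)); split; split.
- move=> L h h0; suff h00 M (d : B L M) : pre d h = 0 by [].
  apply: zP => e; have := h0 (post f e).
  by rewrite lin_formE pre_post -post_comp gf post1.
- move=> L phi; have [h hE] := oP _ (lin_form (post_form_linear f phi)).
  exists h => d; rewrite lin_formE -pre_post -hE lin_formE.
  by rewrite postK.
- move=> M v v0 L d; have := zQ M (g \c v) _ L d; rewrite post_comp => gv0.
  rewrite -[LHS]postK gv0 ?post0 // => e; have := v0 e.
  by rewrite lin_formE -post_comp.
- move=> M phi; have [v vE] := oQ M phi; exists (f \c v) => d.
  by rewrite vE lin_formE -post_comp compA gf comp1m.
Qed.

End Serre.

Lemma serre_pair_op (R : comPzRingType) (I : lmodType R) (P Q : rcat R)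
    (B : bimod P Q) (Z : P) (X : Q) (theta : dual I (B Z X)) :
  serre_pair theta -> @serre_pair R I _ _ (op_bimod B) X Z theta.
Proof. by case=> ? ?; split. Qed.

(** * Almost vanishing classes and the pairings they carry *)

Section AlmostZero.
Variables (R : comPzRingType) (C : rcat R) (B : bimod C C).
Implicit Types X Y Z L M : C.

(** For the Ext bimodule: what remains of an almost split sequence when its middle term is
    forgotten. *)
Definition almost_zero Z X (d : B Z X) : Prop :=
  [/\ d <> 0,
      forall M (r : hom M Z), ~ is_retraction r -> pre d r = 0
    & forall M (s : hom X M), ~ is_section s -> post s d = 0].

(* The self-dual part of the long exact sequences of an extension. *)
Definition realizable : Prop :=
  forall Z X (d : B Z X), exists Y (f : hom X Y) (g : hom Y Z),
    [/\ post f d = 0, pre d g = 0,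
        forall M (e : B M X), post f e = 0 -> exists h : hom M Z, e = pre d h
      & forall M (e : B Z M), pre e g = 0 -> exists h : hom X M, e = post h d].

(** Realise [e]. The map [f] out of [X] kills [e], so it is no section as [e] is non-zero; hence it
    kills [d] too, and exactness makes [d] a multiple of [e]. *)
Lemma almost_zero_pre_multiple Z X L (d : B Z X) (e : B L X) :
  realizable -> almost_zero d -> e <> 0 -> exists h : hom Z L, d = pre e h.
Proof.
move=> real [_ _ dX] e0; have [Y [f [g [fe _ ef _]]]] := real _ _ e.
apply/ef/dX => -[r rf]; apply: e0.
by rewrite -[e]post1 -rf post_comp fe post0.
Qed.

(** The dual argument, stated with the vanishing on the [Z] side alone so that [almost_zero_of_pre]
    can use it before [d] is known to be almost zero. *)
Lemma almost_zero_post_multiple Z X M (d : B Z X) (e : B Z M) :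
  realizable -> (forall M (r : hom M Z), ~ is_retraction r -> pre d r = 0) ->
  e <> 0 -> exists h : hom M X, d = post h e.
Proof.
move=> real dZ e0; have [Y [f [g [_ eg _ ge]]]] := real _ _ e.
apply/ge/dZ => -[s gs]; apply: e0.
by rewrite -[e]pre1 -gs pre_comp eg pre0.
Qed.

(** If a non-section [s] did not kill [d], then [d] would be [post (t \c s) d] for some [t]. As
    [t \c s] is not invertible, [idm X - t \c s] is, yet it kills [d]. *)
Lemma almost_zero_of_pre Z X (d : B Z X) : realizable ->
  strongly_indecomposable X -> d <> 0 ->
  (forall M (r : hom M Z), ~ is_retraction r -> pre d r = 0) -> almost_zero d.
Proof.
move=> real siX d0 dZ; split=> // M s ns; apply: contrapT => sd0.
have [t tE] := almost_zero_post_multiple real dZ sd0.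
have nts : ~ is_iso (t \c s) by apply: not_iso_comp_section.
have [u [uE _]] := strong_indec_iso_1B siX nts.
apply: d0; rewrite -[d]post1 -uE post_comp.
suff -> : post (idm X - t \c s) d = 0 by rewrite post0.
rewrite postBl post1 post_comp -tE.
exact: subrr.
Qed.

Variable I : lmodType R.
Hypotheses (injI : injective_module I) (cogI : cogenerator I).
Hypothesis reflC : hom_reflexive C I.

(** Each half writes [d] as a multiple of a non-zero class at which [theta] would have to vanish. In
    the second half this is the non-degeneracy asked for by [pairing_form_left]. *)
Lemma almost_zero_pre_represents Z X (d : B Z X) (theta : dual I (B Z X)) :
  realizable -> almost_zero d -> evalD d theta <> 0 -> pre_represents theta.
Proof.
move=> real dP theta_d; split=> [L h h0 M e|L phi].
  apply: contrapT => eh0.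
  have [_ dZ _] := dP; have [v vE] := almost_zero_post_multiple real dZ eh0.
  by apply: theta_d; rewrite vE -pre_post.
apply: (@pairing_form_left R I _ _ (fun h e => evalD (pre e h) theta)) => //.
- by move=> e; apply: pre_form_linear_hom.
- by move=> h; apply: pre_form_linear.
move=> e e0; apply: contrapT => /(almost_zero_pre_multiple real dP)[h hE].
by apply: theta_d; rewrite hE.
Qed.

(** Serves the summands [Z] on which [B] vanishes; they are paired with a zero object. *)
Lemma pre_represents_trivial Z X (theta : dual I (B Z X)) :
  (forall M (d : B Z M), d = 0) -> (forall L (d : B L X), d = 0) ->
  pre_represents theta.
Proof.
move=> Z0 X0; split=> [L h _ M d|L phi]; first exact: Z0.
by exists 0 => d; rewrite (X0 _ d) pre0 !(linear_map0 (evalD_lin _)).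
Qed.

(** [theta] adds up the forms on the diagonal blocks, so morphisms are tested, and forms
    represented, one summand at a time. *)
Lemma pre_represents_sum n (Zs Xs : 'I_n -> C) Z X
    (i : forall k, hom (Zs k) Z) (q : forall k, hom Z (Zs k))
    (j : forall k, hom (Xs k) X) (p : forall k, hom X (Xs k))
    (thetas : forall k, dual I (B (Zs k) (Xs k))) (theta : dual I (B Z X)) :
  (forall k, q k \c i k = idm _) -> (forall k l, k != l -> q k \c i l = 0) ->
  (forall k, p k \c j k = idm _) -> (forall k l, k != l -> p k \c j l = 0) ->
  \sum_(k < n) i k \c q k = idm Z -> \sum_(k < n) j k \c p k = idm X ->
  (forall d, evalD d theta =
     \sum_(k < n) evalD (post (p k) (pre d (i k))) (thetas k)) ->
  (forall k, pre_represents (thetas k)) -> pre_represents theta.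
Proof.
move=> qi1 qi0 pj1 pj0 iq1 jp1 thetaE thetasP.
split=> [L h h0 M d|L phi].
  rewrite -[h]compm1 -iq1 comp_sumr.
  rewrite pre_sumr big1 // => k _.
  rewrite compA pre_comp (proj1 (thetasP k)) ?pre0 // => e.
  (* Testing on classes that come from the summand [Xs k] leaves only the [k]-th diagonal block. *)
  have := h0 (post (j k) e).
  rewrite thetaE (bigD1 k) //= big1 ?addr0 => [|l lk].
    by rewrite -pre_comp pre_post -post_comp pj1 post1.
  rewrite -pre_comp pre_post -post_comp pj0 // post0m.
  exact: linear_map0 (evalD_lin _).
pose h k :=
  sval (cid (proj2 (thetasP k) _ (lin_form (post_form_linear (j k) phi)))).
have hE k e : evalD (post (j k) e) phi = evalD (pre e (h k)) (thetas k).
  by rewrite -(svalP (cid (proj2 (thetasP k) _ _)) e).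
exists (\sum_(k < n) h k \c q k) => d; rewrite thetaE.
rewrite -[d in LHS]post1 -jp1.
rewrite post_suml.
rewrite (linear_map_sum _ (evalD_lin phi)); apply: eq_bigr => k _.
rewrite post_comp hE pre_post -pre_comp; congr (evalD (post _ (pre d _)) _).
rewrite comp_suml (bigD1 k) //= big1 => [|l lk].
  by rewrite -compA qi1 compm1 addr0.
by rewrite -compA qi0 // compm0.
Qed.

End AlmostZero.

(** * From almost vanishing classes to Serre pairings and back *)

Section AlmostZeroDuality.
Variables (R : comPzRingType) (C : rcat R) (B : bimod C C).
Implicit Types X Y Z L M : C.

Lemma almost_zero_op Z X (d : B Z X) :
  almost_zero d -> @almost_zero R (op_rcat C) (op_bimod B) X Z d.
Proof. by move=> [d0 dZ dX]; split. Qed.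

Lemma realizable_op : realizable B -> realizable (op_bimod B).
Proof.
by move=> real X Z d; have [Y [f [g [? ? ? ?]]]] := real _ _ d; exists Y, g, f.
Qed.

Variable I : lmodType R.
Hypotheses (injI : injective_module I) (cogI : cogenerator I).
Hypothesis reflC : hom_reflexive C I.
Hypothesis realB : realizable B.

(** Any form non-zero at [d] works; the second half is the first one over the opposite category. *)
Lemma almost_zero_serre_pair Z X (d : B Z X) :
  almost_zero d -> exists theta : dual I (B Z X), serre_pair theta.
Proof.
move=> dP; have [d0 _ _] := dP.
have [theta theta_d] := separating_form cogI d0.
exists theta; split.
  exact: (almost_zero_pre_represents injI reflC realB dP).
exact: (almost_zero_pre_represents injI (hom_reflexive_op reflC)
  (realizable_op realB) (almost_zero_op dP) theta_d).
Qed.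

Lemma serre_pair_trivial Z X (theta : dual I (B Z X)) :
  (forall M (d : B Z M), d = 0) -> (forall L (d : B L X), d = 0) ->
  serre_pair theta.
Proof.
move=> Z0 X0; split; first exact: pre_represents_trivial.
exact: (@pre_represents_trivial R (op_rcat C) (op_bimod B) I X Z theta X0 Z0).
Qed.

Lemma serre_pair_sum n (Zs Xs : 'I_n -> C) Z X
    (thetas : forall k, dual I (B (Zs k) (Xs k))) :
  is_direct_sum Zs Z -> is_direct_sum Xs X ->
  (forall k, serre_pair (thetas k)) ->
  exists theta : dual I (B Z X), serre_pair theta.
Proof.
move=> [i [q [qi1 qi0 iq1]]] [j [p [pj1 pj0 jp1]]] thetasP.
have lf : linear (fun d : B Z X =>
    \sum_(k < n) evalD (post (p k) (pre d (i k))) (thetas k)).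
  move=> a d e; rewrite scaler_sumr -big_split; apply: eq_bigr => k _.
  by rewrite pre_linl post_linr evalD_lin.
exists (lin_form lf); split.
  apply: (pre_represents_sum qi1 qi0 pj1 pj0 iq1 jp1) => // k.
  by case: (thetasP k).
apply: (@pre_represents_sum R (op_rcat C) (op_bimod B) I n Xs Zs X Z p j q i
          thetas)
  => // [k l kl|k l kl|d|k].
- by apply: pj0; rewrite eq_sym.
- by apply: qi0; rewrite eq_sym.
- by rewrite lin_formE; apply: eq_bigr => k _; rewrite -pre_post.
- by case: (thetasP k).
Qed.

(** Each indecomposable summand gets its own partner: a zero object if [B] vanishes on it, otherwise
    the other end of an almost vanishing class. *)
Lemma serre_pair_exists : krull_schmidt C -> additive_rcat C ->
  (forall Z, strongly_indecomposable Z -> ~ (forall M (d : B Z M), d = 0) ->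
     exists X (d : B Z X), almost_zero d) ->
  forall Z, exists X (theta : dual I (B Z X)), serre_pair theta.
Proof.
move=> ksC addC azC Z.
have [n [Zs [Zs_si ZsZ]]] := krull_schmidt_decomposition Z ksC.
have : forall k, exists X (theta : dual I (B (Zs k) X)), serre_pair theta.
  move=> k; have [Zk0|/azC[//|X [d /almost_zero_serre_pair[theta]]]] :=
    pselect (forall M (d : B (Zs k) M), d = 0); last by exists X, theta.
  have [O O0] := additive_zero Z addC.
  exists O, 0; apply: serre_pair_trivial => // L d.
  by rewrite -[d]post1 O0 post0m.
move=> /choice[Xs XsP]; have [X XsX] := addC n Xs.
exists X; apply: (serre_pair_sum (thetas := fun k => sval (cid (XsP k)))) => //.
by move=> k; case: cid.
Qed.

(* The endomorphism rings of Z and X agree up to trivial morphisms, so X has an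
   indecomposable summand carrying all of the pairing; a form on [hom Z Z]
   that vanishes on the radical is then given by an almost vanishing class. *)
Lemma almost_zero_exists Z X (theta : dual I (B Z X)) :
  krull_schmidt C -> strongly_indecomposable Z ->
  ~ (forall M (d : B Z M), d = 0) -> pre_represents theta ->
  (forall b : hom X X, exists a : hom Z Z,
     forall d, evalD (post b d) theta = evalD (pre d a) theta) ->
  exists X' (d : B Z X'), strongly_indecomposable X' /\ almost_zero d.
Proof.
move=> ksC siZ Z0 [trivZ ontoZ] endo.
have triv_not_iso (h : hom Z Z) :
    (forall d, evalD (pre d h) theta = 0) -> ~ is_iso h.
  move=> h0 [g [_ hg]]; apply: Z0 => M d.
  by rewrite -[d]pre1 -hg pre_comp (trivZ _ _ h0) pre0.
have [n [Xs [Xs_si [i [p [pi1 _ ip1]]]]]] := krull_schmidt_decomposition X ksC.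
(* The endomorphisms of [Z] that match, under [theta], the idempotents cutting out the summands of
   [X]. *)
pose a k := sval (cid (endo (i k \c p k))).
have aE k d : evalD (post (i k \c p k) d) theta = evalD (pre d (a k)) theta.
  by rewrite /a; case: cid.
(* Under [theta] the [a k] add up to the identity, so [idm Z] minus their sum acts trivially and is
   not invertible; locality then makes some [a k] invertible. *)
have [k [g [ga _]]] : exists k, is_iso (a k).
  apply: contrapT => /forallNP na.
  have := strong_indec_iso_1B siZ (strong_indec_not_iso_sum siZ na).
  apply: triv_not_iso => d; have dE : evalD d theta =
      \sum_(k < n) evalD (pre d (a k)) theta.
    rewrite -[d in LHS]post1 -ip1 post_suml.
    by rewrite (linear_map_sum _ (evalD_lin theta)); apply: eq_bigr => k _.
  rewrite preBr.
  rewrite pre_sumr pre1.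
  rewrite (linear_mapB (evalD_lin theta)) (linear_map_sum _ (evalD_lin theta)).
  by rewrite dE subrr.
(* Under [theta], [a k] acts as an idempotent and is invertible, hence acts as the identity: the
   summand [Xs k] carries the whole pairing. *)
have ipE d : evalD (post (i k \c p k) d) theta = evalD d theta.
  have dE : d = pre (pre d g) (a k) by rewrite -pre_comp ga pre1.
  rewrite [in LHS]dE -pre_post -aE -post_comp compA -(compA (i k)) pi1 compm1.
  by rewrite aE -dE.
exists (Xs k); pose thetak := lin_form (post_form_linear (i k) theta).
have sep M (e : B M (Xs k)) :
    (forall h : hom Z M, evalD (pre e h) thetak = 0) -> e = 0.
  move=> e0; suff ie0 : post (i k) e = 0.
    by rewrite -[e]post1 -pi1 post_comp ie0 post0.
  apply: (pre_represents_separates (theta := theta) cogI) => // h.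
  by rewrite pre_post; apply: (e0 h).
have ker_not_iso (h : hom Z Z) :
    (forall d, evalD (pre d h) thetak = 0) -> ~ is_iso h.
  move=> h0; apply: triv_not_iso => d.
  by rewrite -ipE post_comp -[LHS]/(evalD _ thetak) -pre_post h0.
(* The radical of the local ring. It is stable under scalars: an inverse [r] of [c *: f] would yield
   the inverse [c *: r] of [f]. *)
have rad_closed : submod_closed (fun h : hom Z Z => `[< ~ is_iso h >]).
  split=> [|c f h /asboolP nf /asboolP nh]; apply/asboolP.
    exact: strong_indec_not_iso0.
  apply: (proj2 siZ) => // -[r [rf fr]]; apply: nf; exists (c *: r).
  by rewrite compZr -compZl compZl -compZr.
have [|phi [phi0 phi1]] :=
  @separating_form_mod _ _ cogI _ (Submodule rad_closed) (idm Z).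
  by apply/asboolP; apply; apply: is_iso_idm.
have lin_l (d : B Z (Xs k)) :
    linear (fun h : hom Z Z => evalD (pre d h) thetak).
  exact: pre_form_linear_hom.
have lin_r (h : hom Z Z) :
    linear (fun d : B Z (Xs k) => evalD (pre d h) thetak).
  exact: pre_form_linear.
(* The left kernel of the pairing consists of non-units, where [phi] vanishes, so a class [d]
   represents [phi]. *)
have [h h0|d dE] :=
  pairing_form_right cogI lin_l lin_r (reflC Z Z) (phi := phi).
  by apply: phi0; apply/asboolP; apply: ker_not_iso.
exists d; split=> //; apply: almost_zero_of_pre => // [d0|M r nr].
  by apply: phi1; rewrite dE d0 pre0 (linear_map0 (evalD_lin _)).
(* For a non-retraction [r] every [r \c h] is a non-unit, hence killed by [phi]; so [pre d r] pairs
   to zero with every [h]. *)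
apply: sep => h; rewrite -pre_comp -dE; apply: phi0; apply/asboolP.
exact: not_iso_comp_retraction.
Qed.
End AlmostZeroDuality.

(** * Auslander-Reiten functors for a bimodule, and their description by Serre pairings *)

Section ARFunctor.
Variables (R : comPzRingType) (I : lmodType R) (P Q : rcat R) (B : bimod P Q).

Definition pre_faithful : Prop :=
  forall (Z L : P) (h : hom Z L),
    (forall (M : Q) (d : B L M), pre d h = 0) -> h = 0.

Definition post_faithful : Prop :=
  forall (X M : Q) (v : hom M X),
    (forall (L : P) (d : B L M), post v d = 0) -> v = 0.

Definition AR_functor (tau : functor P Q) : Prop :=
  exists Phi : forall X Y : P, {linear hom X Y -> dual I (B Y (tau X))},
    (forall X Y, bijective (Phi X Y)) /\
    (forall (X X' Y Y' : P) (a : hom X' X) (b : hom Y Y') (x : hom X Y)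
        (d : B Y' (tau X')),
      evalD d (Phi X' Y' (b \c x \c a)) =
      evalD (post (fmor tau a) (pre d b)) (Phi X Y x)).

(** By Yoneda a binatural family [Phi] amounts to the forms [Phi Z Z (idm Z)]; this is what
    naturality says of them. *)
Definition AR_form (tau : functor P Q)
    (theta : forall Z, dual I (B Z (tau Z))) : Prop :=
  forall (X X' : P) (a : hom X' X) (d : B X (tau X')),
    evalD (pre d a) (theta X') = evalD (post (fmor tau a) d) (theta X).

Hypotheses (faithP : pre_faithful) (faithQ : post_faithful).

Lemma AR_functorP (tau : functor P Q) :
  AR_functor tau <-> exists theta : forall Z, dual I (B Z (tau Z)),
    AR_form theta /\ forall Z, pre_represents (theta Z).
Proof.
split=> [[Phi [Phi_bij PhiN]]|[theta [thetaN thetaP]]].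
  have PhiE X Y (x : hom X Y) d :
      evalD d (Phi X Y x) = evalD (pre d x) (Phi X X (idm X)).
    have := PhiN _ _ _ _ (idm X) x (idm X) d.
    by rewrite !compm1 fmor_id post1.
  exists (fun Z => Phi Z Z (idm Z)); split=> [X X' a d|Z].
    have := PhiN _ _ _ _ a (idm X) (idm X) d.
    by rewrite !comp1m pre1 -PhiE.
  split=> [L h h0 M d|L phi]; last first.
    have [Psi _ PhiK] := Phi_bij Z L; exists (Psi phi) => d.
    by rewrite -PhiE PhiK.
  suff -> : h = 0 by exact: prem0.
  apply: (bij_inj (Phi_bij Z L)); apply: dual_ext => {M}d.
  by rewrite PhiE h0 [Phi _ _ 0]raddf0.
have lPhi X Y : linear (fun x : hom X Y =>
    lin_form (@pre_form_linear _ _ _ _ B _ _ _ x (theta X))).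
  by move=> c x y; apply: dual_ext => d; rewrite lin_formE pre_linr evalD_lin.
exists (fun X Y => lin_map (lPhi X Y)); split=> [X Y|X X' Y Y' a b x d].
  have [inj onto] := thetaP X.
  apply: inj_surj_bijective => [x y xy|phi].
    apply/eqP; rewrite -subr_eq0; apply/eqP/faithP => M d.
    apply: inj => {M}d; rewrite preBr.
    rewrite (linear_mapB (evalD_lin _)).
    by move/(congr1 (evalD d)): xy => /= ->; exact: subrr.
  by have [h hE] := onto _ phi; exists h; apply: dual_ext.
rewrite -[LHS]/(evalD (pre d _) (theta X')) -[RHS]/(evalD (pre _ x) (theta X)).
by rewrite pre_comp thetaN -!pre_post -!pre_comp.
Qed.

(** Up to isomorphism every object of [Q] is some [tau W], and a morphism from [tau W] to [tau Z] is
    some [tau a]. [AR_form] turns [theta (tau a -)] into [theta (- a)], to which [pre_represents]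
    applies. *)
Lemma AR_form_full_serre_pair (tau : functor P Q)
    (theta : forall Z, dual I (B Z (tau Z))) :
  AR_form theta -> (forall Z, pre_represents (theta Z)) -> full_functor tau ->
  essentially_surjective tau -> forall Z, serre_pair (theta Z).
Proof.
move=> thetaN thetaP full surj Z; split=> //.
have [injZ ontoZ] := thetaP Z.
split=> [M v v0 L d|M phi].
  have [W [f [g [gf fg]]]] := surj M.
  suff vf0 : v \c f = 0.
    by rewrite -[v]compm1 -fg compA vf0 comp0m post0m.
  have [a aE] := full _ _ (v \c f).
  (* [tau] is not known to preserve zero morphisms; a preimage [c] of zero is shown to vanish by the
     same argument as [a]. *)
  have [c c0] := full _ _ (0 : hom (tau W) (tau Z)).
  have a0 (h : hom W Z) (k : hom (tau W) (tau Z)) : fmor tau h = k ->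
      (forall d, evalD (post k d) (theta Z) = 0) -> h = 0.
    move=> hk k0; apply: faithP => N e; apply: (proj1 (thetaP W)) => {N}e.
    by rewrite thetaN hk.
  rewrite -aE (a0 _ _ aE) => [|e]; last by rewrite post_comp.
  rewrite -c0; congr fmor; apply/esym/(a0 _ _ c0) => e.
  by rewrite post0m (linear_map0 (evalD_lin _)).
have [W [f [g [gf fg]]]] := surj M.
have [a aE] := proj2 (thetaP W) _ (lin_form (post_form_linear f phi)).
exists (fmor tau a \c g) => d; rewrite post_comp -thetaN -aE lin_formE.
by rewrite -post_comp fg post1.
Qed.

Lemma AR_form_full_endo (tau : functor P Q)
    (theta : forall Z, dual I (B Z (tau Z))) (Z : P) :
  AR_form theta -> full_functor tau -> forall b : hom (tau Z) (tau Z),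
    exists a : hom Z Z,
      forall d, evalD (post b d) (theta Z) = evalD (pre d a) (theta Z).
Proof.
move=> thetaN full b; have [a <-] := full _ _ b.
by exists a => d; rewrite thetaN.
Qed.

Lemma AR_form_faithful (tau : functor P Q)
    (theta : forall Z, dual I (B Z (tau Z))) :
  AR_form theta -> (forall Z, pre_represents (theta Z)) -> faithful_functor tau.
Proof.
move=> thetaN thetaP X Y f g fg; apply/eqP; rewrite -subr_eq0; apply/eqP/faithP.
move=> M d; apply: (proj1 (thetaP X)) => {M}d.
rewrite preBr (linear_mapB (evalD_lin _)).
by rewrite !thetaN fg; exact: subrr.
Qed.

(** [tau] sends [a] to the only morphism representing [theta (- a)], and uniqueness yields
    functoriality. It is full because, conversely, each [theta (g -)] is [theta (- a)] for some
    [a]. *)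
Lemma serre_pair_functor :
  (forall Z, exists X (theta : dual I (B Z X)), serre_pair theta) ->
  exists (tau : functor P Q) (theta : forall Z, dual I (B Z (tau Z))),
    [/\ AR_form theta, forall Z, serre_pair (theta Z) & full_functor tau].
Proof.
move=> /choice[T HT]; pose theta Z := sval (cid (HT Z)).
have thetaS Z : serre_pair (theta Z) := svalP (cid (HT Z)).
have uniq (M : Q) (Z : P) (u v : hom M (T Z)) : (forall d : B Z M,
    evalD (post u d) (theta Z) = evalD (post v d) (theta Z)) -> u = v.
  move=> uv; apply/eqP; rewrite -subr_eq0; apply/eqP/faithQ => L d.
  apply: (proj1 (proj2 (thetaS Z))) => {L}d.
  rewrite postBl (linear_mapB (evalD_lin _)).
  by rewrite uv; exact: subrr.
have ex X X' (a : hom X' X) : exists u : hom (T X') (T X),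
    forall d : B X (T X'),
      evalD (pre d a) (theta X') = evalD (post u d) (theta X).
  exact: (proj2 (proj2 (thetaS X)) _ (lin_form (pre_form_linear a (theta X')))).
pose Tm (X' X : P) (a : hom X' X) := sval (cid (ex X X' a)).
have TmE X X' (a : hom X' X) (d : B X (T X')) :
    evalD (pre d a) (theta X') = evalD (post (Tm _ _ a) d) (theta X).
  exact: (svalP (cid (ex X X' a))).
have Tm1 X : Tm _ _ (idm X) = idm (T X).
  by apply: uniq => d; rewrite -TmE pre1 post1.
have Tmc X Y Z (g : hom Y Z) (f : hom X Y) :
    Tm _ _ (g \c f) = Tm _ _ g \c Tm _ _ f.
  by apply: uniq => d; rewrite -TmE pre_comp TmE -pre_post TmE post_comp.
exists (Functor Tm1 Tmc), theta; split=> //.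
move=> X Y g /=; have [[_ onto] _] := thetaS X.
have [a aE] := onto _ (lin_form (post_form_linear g (theta Y))).
by exists a; apply: uniq => d; rewrite -TmE -aE.
Qed.

(** Both partners represent the dual of [B Z -], so Yoneda identifies them. *)
Lemma serre_pair_unique (Z : P) (X X' : Q) (theta : dual I (B Z X))
    (theta' : dual I (B Z X')) :
  serre_pair theta -> serre_pair theta' -> exists f : hom X X', is_iso f.
Proof.
move=> [_ [injX ontoX]] [_ [injX' ontoX']].
have [f fE] := ontoX' _ theta; have [g gE] := ontoX _ theta'.
exists f, g; split; apply/eqP; rewrite -subr_eq0; apply/eqP/faithQ => L d.
  apply: injX => {L}d; rewrite postBl.
  by rewrite (linear_mapB (evalD_lin _)) post1 post_comp -gE -fE; exact: subrr.
apply: injX' => {L}d; rewrite postBl.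
by rewrite (linear_mapB (evalD_lin _)) post1 post_comp -fE -gE; exact: subrr.
Qed.

Lemma full_AR_functor_exists :
  (forall Z, exists X (theta : dual I (B Z X)), serre_pair theta) ->
  exists tau : functor P Q, AR_functor tau /\ full_functor tau.
Proof.
move=> /serre_pair_functor[tau [theta [thetaN thetaS full]]].
exists tau; split=> //; apply/AR_functorP; exists theta; split=> // Z.
by case: (thetaS Z).
Qed.

(** Fullness stands in for the second half of a Serre pairing by supplying the transfer of
    endomorphisms. *)
Lemma full_AR_functor_represents (tau : functor P Q) (Z : P) :
  AR_functor tau -> full_functor tau ->
  exists X (theta : dual I (B Z X)), pre_represents theta /\
    forall b : hom X X, exists a : hom Z Z,
      forall d, evalD (post b d) theta = evalD (pre d a) theta.
Proof.
move=> /AR_functorP[theta [thetaN thetaP]] full; exists (tau Z), (theta Z).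
by split=> //; apply: AR_form_full_endo.
Qed.

(** Essential surjectivity of an equivalence gives every [X] a partner. Conversely, the functor
    built from partners is full and faithful, and uniqueness of partners makes it essentially
    surjective. *)
Lemma AR_equivalenceP :
  (exists tau : functor P Q, AR_functor tau /\ equivalence_functor tau) <->
  (forall Z, exists X (theta : dual I (B Z X)), serre_pair theta) /\
  (forall X, exists Z (theta : dual I (B Z X)), serre_pair theta).
Proof.
split=> [[tau [/AR_functorP[theta [thetaN thetaP]]]]|[exZ exX]].
  case/equivalence_fully_faithful=> full _ surj.
  have thetaS := AR_form_full_serre_pair thetaN thetaP full surj.
  split=> [Z|X]; first by exists (tau Z), (theta Z).
  have [Z [f fI]] := surj X; exists Z; exact: serre_pair_iso fI (thetaS Z).
have [tau [theta [thetaN thetaS full]]] := serre_pair_functor exZ.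
have thetaP Z : pre_represents (theta Z) by case: (thetaS Z).
exists tau; split; first by apply/AR_functorP; exists theta.
apply: fully_faithful_equivalence => //; first exact: AR_form_faithful thetaP.
move=> X; have [Z [theta' theta'S]] := exX X.
by exists Z; apply: serre_pair_unique (thetaS Z) theta'S.
Qed.
End ARFunctor.

(** * Exactness properties of triangles *)

Section Triangles.
Variables (R : comPzRingType) (A : tricat R).
Local Notation T := (shift A).
Implicit Types X Y Z M : A.

Lemma shift_faithful : faithful_functor T.
Proof. by case: (equivalence_fully_faithful (shift_equivalence A)). Qed.

Lemma shift_full : full_functor T.
Proof. by case: (equivalence_fully_faithful (shift_equivalence A)). Qed.

Lemma shift_surj : essentially_surjective T.
Proof. by case: (equivalence_fully_faithful (shift_equivalence A)). Qed.

Lemma shift0 X Y : fmor T (0 : hom X Y) = 0.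
Proof. exact: (linear_map0 (@shift_linear _ A X Y)). Qed.

Lemma shiftN X Y (f : hom X Y) : fmor T (- f) = - fmor T f.
Proof.
by have := linear_mapB (@shift_linear _ A X Y) 0 f; rewrite shift0 !sub0r.
Qed.

Lemma is_zero_shift X : is_zero X -> is_zero (T X).
Proof.
by move=> /is_zero_idm X0; apply/is_zero_idm; rewrite -fmor_id X0 shift0.
Qed.

Lemma zero_object_exists X : exists O : A, is_zero O.
Proof.
by have [O /is_zero_idm] := additive_zero X (@tricat_additive R A); exists O.
Qed.

Section ExactTriangle.
Variables (X Y Z : A) (u : hom X Y) (v : hom Y Z) (w : hom Z (T X)).
Hypothesis tri : exact_triangle u v w.

Lemma triangle_rotate : exact_triangle v w (- fmor T u).
Proof. exact/(tricat_rotate u v w). Qed.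

(** A morphism from the trivial triangle on [X] makes [v \c u] factor through a zero object. *)
Lemma triangle_comp0 : v \c u = 0.
Proof.
have [O O0] := zero_object_exists X.
have [c [cE _]] := tricat_morphism (tricat_trivial X O0) tri
  (etrans (compm1 u) (esym (compm1 u))).
by rewrite -cE compm0.
Qed.

(** Compare the rotated trivial triangle on [M] with the rotation of the given one; [h] is the
    preimage of the third map under the full and faithful shift. *)
Lemma triangle_lift M (g : hom M Y) : v \c g = 0 -> exists h, g = u \c h.
Proof.
move=> vg; have [O O0] := zero_object_exists M.
have tM := proj1 (tricat_rotate _ _ _) (tricat_trivial M O0).
have [|c [_ cE]] :=
  tricat_morphism (a := g) (b := (0 : hom O Z)) tM triangle_rotate.
  by rewrite vg comp0m.
have [h hE] := shift_full c; exists h; apply: shift_faithful.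
move: cE; rewrite fmor_comp hE fmor_id compNr compNl compm1.
exact: oppr_inj.
Qed.

Lemma triangle_extend M (g : hom Y M) : g \c u = 0 -> exists h, g = h \c v.
Proof.
move=> gu; have [O O0] := zero_object_exists M.
have tM : exact_triangle (0 : hom O M) (idm M) (0 : hom M (T O)).
  apply/tricat_rotate; rewrite shift0 oppr0.
  exact/tricat_trivial/is_zero_shift.
have [|c [cE _]] := tricat_morphism (a := (0 : hom X O)) (b := g) tri tM.
  by rewrite gu comp0m.
by exists c; rewrite cE comp1m.
Qed.
End ExactTriangle.

Section LongExact.
Variables (X Y Z : A) (u : hom X Y) (v : hom Y Z) (w : hom Z (T X)).
Hypothesis tri : exact_triangle u v w.

Lemma triangle_comp0_r : w \c v = 0.
Proof. exact: triangle_comp0 (triangle_rotate tri). Qed.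

Lemma triangle_comp0_l : fmor T u \c w = 0.
Proof.
have := triangle_comp0 (triangle_rotate (triangle_rotate tri)).
by rewrite compNl => /eqP; rewrite oppr_eq0 => /eqP.
Qed.

Lemma triangle_lift_r M (g : hom M Z) : w \c g = 0 -> exists h, g = v \c h.
Proof. by move=> wg; apply: (triangle_lift (triangle_rotate tri) wg). Qed.

Lemma triangle_lift_shift M (e : hom M (T X)) :
  fmor T u \c e = 0 -> exists h, e = w \c h.
Proof.
move=> ue; apply: (triangle_lift (triangle_rotate (triangle_rotate tri))).
by rewrite compNl ue oppr0.
Qed.

Lemma triangle_extend_shift M (e : hom Z (T M)) :
  e \c v = 0 -> exists h : hom X M, e = fmor T h \c w.
Proof.
move=> /(triangle_extend (triangle_rotate tri))[c ->].
by have [h <-] := shift_full c; exists h.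
Qed.

Lemma triangle_extend_l M (g : hom X M) :
  fmor T g \c w = 0 -> exists h, g = h \c u.
Proof.
move=> /(triangle_extend (triangle_rotate (triangle_rotate tri)))[c cE].
have [h hE] := shift_full c; exists (- h); apply: shift_faithful.
by rewrite fmor_comp shiftN hE cE compNr compNl.
Qed.
End LongExact.

(** The third term of a triangle on [d] is isomorphic to some [T Y]; rotating back twice puts [Y] in
    the middle. *)
Lemma triangle_of_class X Z (d : hom Z (T X)) :
  exists Y (u : hom X Y) (v : hom Y Z), exact_triangle u v d.
Proof.
have [W [v [w tri]]] := tricat_cone d.
have [Y [s [r [rs sr]]]] := shift_surj W.
have [f fE] := shift_full (r \c v); have [g gE] := shift_full (w \c s).
(* These signs cancel those introduced by the two rotations. *)
exists Y, (- f), (- g).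
apply/tricat_rotate/tricat_rotate; rewrite !shiftN !opprK fE gE.
apply: (tricat_iso_closed (a := idm Z) (b := idm (T X)) (c := r)
          _ _ _ _ _ _ tri).
- exact: is_iso_idm.
- exact: is_iso_idm.
- by exists s.
- by rewrite comp1m compm1.
- by rewrite compm1.
- by rewrite fmor_id comp1m -compA sr compm1.
Qed.
End Triangles.

(** * Tri-exact categories: additivity, the Ext bimodule and almost split sequences *)

Section TriexactCategory.
Variables (R : comPzRingType) (C : triexact R).
Local Notation A := (ambient C).
Local Notation T := (shift A).

(** Such an [X] is an extension of the given zero object by itself. *)
Lemma in_triexact_zero (X : A) : is_zero X -> in_triexact X.
Proof.
move=> X0; have [O [O0 CO]] := triexact_zero C.
have tX : exact_triangle (0 : hom O X) (0 : hom X O) (0 : hom O (T O)).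
  have zero_iso (U V : A) (h : hom U V) : is_zero U -> is_zero V -> is_iso h.
    move=> U0 V0; exists 0; rewrite compm0 comp0m.
    by split; apply/esym/is_zero_idm.
  apply: (tricat_iso_closed (a := 0) (b := 0) (c := 0) _ _ _ _ _ _
            (tricat_trivial O O0)); rewrite ?compm0 ?comp0m //; exact: zero_iso.
exact: (triexact_ext tX CO CO).
Qed.

(** Induction on [n]: the cone [E] of the first inclusion is a direct sum of the other summands, and
    [X] is an extension of [E] by the first summand. *)
Lemma in_triexact_sum n (Y : 'I_n -> A) (X : A) :
  is_direct_sum Y X -> (forall k, in_triexact (Y k)) -> in_triexact X.
Proof.
elim: n Y X => [|n IHn] Y X [i [p [pi1 pi0 ip1]]] CY.
  by apply/in_triexact_zero/is_zero_idm; rewrite -ip1 big_ord0.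
have [E [v [w tri]]] := tricat_cone (i ord0).
have w0 : w = 0.
  have := triangle_comp0_l tri => /(congr1 (comp (fmor T (p ord0)))).
  by rewrite compA -fmor_comp pi1 fmor_id comp1m compm0.
have [|s0 s0E] := triangle_lift_r tri (g := idm E); first by rewrite w0 comp0m.
have vi0 := triangle_comp0 tri.
(* Correcting the section [s0] by the projector [e] gives [p ord0 \c s = 0], which makes [s \c v]
   exactly [e]. *)
pose e := idm X - i ord0 \c p ord0; pose s := e \c s0.
have ve : v \c e = v by rewrite compBr compm1 compA vi0 comp0m subr0.
have pe : p ord0 \c e = 0 by rewrite compBr compm1 compA pi1 comp1m subrr.
have vs : v \c s = idm E by rewrite compA ve.
have sv : s \c v = e.
  have : v \c (s \c v - e) = 0 by rewrite compBr compA vs comp1m ve subrr.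
  move=> /(triangle_lift tri)[t tE].
  have t0 : t = 0.
    have := congr1 (comp (p ord0)) tE.
    by rewrite compA pi1 comp1m compBr !compA pe !comp0m subr0.
  by apply/eqP; rewrite -subr_eq0 tE t0 compm0.
apply: (triexact_ext tri) => //.
apply: (IHn (fun k => Y (lift ord0 k))) => //.
have e_i k : e \c i (lift ord0 k) = i (lift ord0 k).
  by rewrite compBl comp1m -compA pi0 ?neq_lift // compm0 subr0.
exists (fun k => v \c i (lift ord0 k)), (fun k => p (lift ord0 k) \c s).
split=> [k|j k jk|].
- by rewrite -compA (compA s) sv e_i pi1.
- by rewrite -compA (compA s) sv e_i pi0 // (inj_eq lift_inj).
rewrite -[RHS]vs -[s in RHS]comp1m -ip1 big_ord_recl compDl compDr.
rewrite -(compA (i ord0)) /s !(compA (p ord0)) pe !comp0m !compm0 add0r.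
rewrite comp_suml comp_sumr; apply: eq_bigr => k _.
by rewrite !compA.
Qed.

Lemma triexact_additive : additive_rcat C.
Proof.
move=> n Y; have [X XY] := @tricat_additive R A n (fun k => sval (Y k)).
have CX : in_triexact X by apply: (in_triexact_sum XY) => k; apply: svalP.
by exists (exist _ X CX).
Qed.

Definition ext_bimod : bimod C C :=
  @Bimod R C C (@Ext R C)
    (fun (X X' Y : C) d f => ext_pre d f) (fun (X Y Y' : C) g d => ext_post g d)
    (fun X X' Y f => @comp_linl R A _ _ _ f)
    (fun X X' Y d => @ext_pre_linr R C X' X Y d)
    (fun X Y Y' d => @ext_post_linl R C Y Y' X d)
    (fun X Y Y' g => @comp_linr R A _ _ _ (fmor T g))
    (fun X Y d => compm1 d)
    (fun X Y d =>
       etrans (congr1 (fun f => f \c d) (fmor_id T (sval Y))) (comp1m d))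
    (fun X X' X'' Y d f g => ext_pre_comp d f g)
    (fun X Y Y' Y'' g f d => ext_post_comp g f d)
    (fun (X X' Y Y' : C) g d f => esym (@compA R A _ _ _ _ (fmor T g) d f)).

Lemma triexact_triangle (X Z : C) (d : Ext Z X) :
  exists (Y : C) (f : hom X Y) (g : hom Y Z),
    @exact_triangle R A (sval X) (sval Y) (sval Z) f g d.
Proof.
have [Y [f [g tri]]] := triangle_of_class (d : hom (sval Z) (T (sval X))).
have CY : in_triexact Y by apply: (triexact_ext tri); apply: svalP.
by exists (exist _ Y CY), f, g.
Qed.

Lemma ext_bimod_realizable : realizable ext_bimod.
Proof.
move=> Z X d; have [Y [f [g tri]]] := triexact_triangle d.
exists Y, f, g; split.
- exact: triangle_comp0_l tri.
- exact: triangle_comp0_r tri.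
- by move=> M e fe; apply: (triangle_lift_shift tri fe).
- by move=> M e eg; apply: (triangle_extend_shift tri eg).
Qed.

Lemma almost_split_sequence_almost_zero (X Y Z : C)
    (f : hom X Y) (g : hom Y Z) :
  almost_split_sequence f g -> exists d : ext_bimod Z X, almost_zero d.
Proof.
move=> [[d tri] [_ [fn fs]] [_ [gn gs]]].
have dg : pre (d : ext_bimod Z X) g = 0 := triangle_comp0_r tri.
have fd : post f (d : ext_bimod Z X) = 0 := triangle_comp0_l tri.
exists d; split=> [d0|M r nr|M s ns].
- apply: gn; have [|s sE] := triangle_lift_r tri (g := idm (sval Z)).
    by rewrite compm1.
  by exists s.
- by have [h ->] := gs _ _ nr; rewrite pre_comp dg pre0.
- by have [h ->] := fs _ _ ns; rewrite post_comp fd post0.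
Qed.

(** Exactness turns the vanishing conditions on [d] into factorisations. For minimality,
    [h \c f = f] gives [h = idm Y - t \c g]; locality makes [idm Z - g \c t] invertible, and
    Jacobson's identity carries this over to [h]. The other side is dual. *)
Lemma almost_zero_almost_split_sequence (X Z : C) (d : ext_bimod Z X) :
  strongly_indecomposable X -> strongly_indecomposable Z -> almost_zero d ->
  exists Y (f : hom X Y) (g : hom Y Z), almost_split_sequence f g.
Proof.
move=> siX siZ [d0 dZ dX]; have [Y [f [g tri]]] := triexact_triangle d.
have dg : pre d g = 0 := triangle_comp0_r tri.
have fd : post f d = 0 := triangle_comp0_l tri.
have fn : ~ is_section f.
  by move=> [r rf]; apply: d0; rewrite -[d]post1 -rf post_comp fd post0.
have gn : ~ is_retraction g.
  by move=> [s gs]; apply: d0; rewrite -[d]pre1 -gs pre_comp dg pre0.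
exists Y, f, g; split; first by exists d.
- split=> [h hf|].
    have hf0 : (idm Y - h) \c f = 0 by rewrite compBl comp1m hf subrr.
    have [t tE] : exists t : hom Z Y, idm Y - h = t \c g :=
      triangle_extend tri hf0.
    have -> : h = idm Y - t \c g by rewrite -tE subKr.
    apply/is_iso_1B/strong_indec_iso_1B => //.
    exact: not_iso_comp_retraction.
  split=> // M u nu; exact: (triangle_extend_l tri (dX _ _ nu)).
split=> [h gh|].
  have gh0 : g \c (idm Y - h) = 0 by rewrite compBr compm1 gh subrr.
  have [t tE] : exists t : hom Y X, idm Y - h = f \c t := triangle_lift tri gh0.
  have -> : h = idm Y - f \c t by rewrite -tE subKr.
  by apply/is_iso_1B/strong_indec_iso_1B => //; apply: not_iso_comp_section.
split=> // M u nu; exact: (triangle_lift_r tri (dZ _ _ nu)).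
Qed.
End TriexactCategory.

(** * Ext over the stable categories, and almost split sequences in terms of Serre pairings *)

Section StableBimodule.
Variables (R : comPzRingType) (C : triexact R).
Local Notation under := (under_cat C).
Local Notation over := (over_cat C).
Local Notation piU := (proj_hom (projt_ideal C)).
Local Notation piO := (proj_hom (injt_ideal C)).

Lemma under_ind (X Y : C) (K : @hom R under X Y -> Prop) :
  (forall f : hom X Y, K (piU f)) -> forall f, K f.
Proof. by move=> Kpi f; rewrite -[f]lift_homK. Qed.

Lemma over_ind (X Y : C) (K : @hom R over X Y -> Prop) :
  (forall f : hom X Y, K (piO f)) -> forall f, K f.
Proof. by move=> Kpi f; rewrite -[f]lift_homK. Qed.

Lemma ext_under_linl (X X' Y : C) (f : @hom R under X' X) :
  linear (fun d : Ext X Y => ext_under d f).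
Proof. exact: (@pre_linl _ _ _ (ext_bimod C)). Qed.

Lemma ext_under_linr (X X' Y : C) (d : Ext X Y) :
  linear (fun f : @hom R under X' X => ext_under d f).
Proof.
move=> a; elim/under_ind=> f; elim/under_ind=> g.
by rewrite -proj_hom_linear !ext_under_proj ext_pre_linr.
Qed.

Lemma ext_over_linl (X Y Y' : C) (d : Ext X Y) :
  linear (fun g : @hom R over Y Y' => ext_over g d).
Proof.
move=> a; elim/over_ind=> f; elim/over_ind=> g.
by rewrite -proj_hom_linear !ext_over_proj ext_post_linl.
Qed.

Lemma ext_over_linr (X Y Y' : C) (g : @hom R over Y Y') :
  linear (fun d : Ext X Y => ext_over g d).
Proof. exact: (@post_linr _ _ _ (ext_bimod C)). Qed.

Lemma ext_under1 (X Y : C) (d : Ext X Y) : ext_under d (@idm R under X) = d.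
Proof. by rewrite ext_under_proj; apply: (@pre1 _ _ _ (ext_bimod C)). Qed.

Lemma ext_over1 (X Y : C) (d : Ext X Y) : ext_over (@idm R over Y) d = d.
Proof. by rewrite ext_over_proj; apply: (@post1 _ _ _ (ext_bimod C)). Qed.

Lemma ext_under_comp (X X' X'' Y : C) (d : Ext X Y) (f : @hom R under X' X)
    (g : @hom R under X'' X') :
  ext_under d (f \c g) = ext_under (ext_under d f) g.
Proof.
elim/under_ind: f => f; elim/under_ind: g => g.
by rewrite [_ \c _]quot_comp_proj !ext_under_proj ext_pre_comp.
Qed.

Lemma ext_over_comp (X Y Y' Y'' : C) (g : @hom R over Y' Y'')
    (f : @hom R over Y Y') (d : Ext X Y) :
  ext_over (g \c f) d = ext_over g (ext_over f d).
Proof.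
elim/over_ind: f => f; elim/over_ind: g => g.
by rewrite [_ \c _]quot_comp_proj !ext_over_proj ext_post_comp.
Qed.

Lemma ext_under_over (X X' Y Y' : C) (g : @hom R over Y Y') (d : Ext X Y)
    (f : @hom R under X' X) :
  ext_under (ext_over g d) f = ext_over g (ext_under d f).
Proof. exact: (@pre_post _ _ _ (ext_bimod C)). Qed.

Definition stable_bimod : bimod under over :=
  @Bimod R under over (@Ext R C) (@ext_under R C) (@ext_over R C)
    ext_under_linl ext_under_linr ext_over_linl ext_over_linr
    ext_under1 ext_over1 ext_under_comp ext_over_comp ext_under_over.

Lemma stable_pre_faithful : pre_faithful stable_bimod.
Proof.
move=> Z L; elim/under_ind=> h h0.
apply: etrans (linear_map0 (@proj_hom_linear _ _ (projt_ideal C) Z L)).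
apply/quot_piP; rewrite subr0; apply/asboolP => M d.
by rewrite -ext_under_proj; apply: h0.
Qed.

Lemma stable_post_faithful : post_faithful stable_bimod.
Proof.
move=> X M; elim/over_ind=> h h0.
apply: etrans (linear_map0 (@proj_hom_linear _ _ (injt_ideal C) M X)).
apply/quot_piP; rewrite subr0; apply/asboolP => L d.
by rewrite -ext_over_proj; apply: h0.
Qed.

Variable I : lmodType R.

(** Representation is formulated modulo morphisms acting trivially, so replacing morphisms by their
    stable classes changes nothing. *)
Lemma pre_represents_stable (Z X : C) (theta : dual I (Ext Z X)) :
  @pre_represents R I _ _ stable_bimod Z X theta <->
  @pre_represents R I _ _ (ext_bimod C) Z X theta.
Proof.
split=> -[inj onto]; split=> [L h h0 M d|L phi].
- rewrite -[LHS](ext_under_proj d h); apply: inj => {M}d.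
  by rewrite -[RHS](h0 d); congr evalD; apply: ext_under_proj.
- by have [h hE] := onto L phi; exists (lift_hom h).
- exact: (inj _ _ h0).
have [h hE] := onto L phi; exists (piU h) => d.
by rewrite hE; congr evalD; apply/esym/ext_under_proj.
Qed.

Lemma post_represents_stable (Z X : C) (theta : dual I (Ext Z X)) :
  @post_represents R I _ _ stable_bimod Z X theta <->
  @post_represents R I _ _ (ext_bimod C) Z X theta.
Proof.
split=> -[inj onto]; split=> [L h h0 M d|L phi].
- rewrite -[LHS](ext_over_proj h d); apply: inj => {M}d.
  by rewrite -[RHS](h0 d); congr evalD; apply: ext_over_proj.
- by have [h hE] := onto L phi; exists (lift_hom h).
- exact: (inj _ _ h0).
have [h hE] := onto L phi; exists (piO h) => d.
by rewrite hE; congr evalD; apply/esym/ext_over_proj.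
Qed.

Lemma serre_pair_stable (Z X : C) (theta : dual I (Ext Z X)) :
  @serre_pair R I _ _ stable_bimod Z X theta <->
  @serre_pair R I _ _ (ext_bimod C) Z X theta.
Proof.
by split=> -[/pre_represents_stable ? /post_represents_stable ?].
Qed.

Hypotheses (injI : injective_module I) (cogI : cogenerator I).
Hypotheses (reflC : hom_reflexive C I) (ksC : krull_schmidt C).

Definition has_serre_targets : Prop :=
  forall Z, exists X (theta : dual I (stable_bimod Z X)), serre_pair theta.
Definition has_serre_sources : Prop :=
  forall X, exists Z (theta : dual I (stable_bimod Z X)), serre_pair theta.

Lemma has_ass_right_serre : has_ass_right C -> has_serre_targets.
Proof.
move=> assR Z.
have [Y Ysi Yp|X [theta]] := serre_pair_exists injI cogI reflC
  (@ext_bimod_realizable R C) ksC (@triexact_additive R C) _ Z.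
  have [X [E [f [g /almost_split_sequence_almost_zero[d]]]]] := assR Y Ysi Yp.
  by exists X, d.
by move=> /serre_pair_stable; exists X, theta.
Qed.

Lemma has_ass_left_serre : has_ass_left C -> has_serre_sources.
Proof.
move=> assL X.
have [Y /strongly_indecomposable_op Ysi Yp|Z [theta]] :=
  serre_pair_exists injI cogI (hom_reflexive_op reflC)
  (realizable_op (@ext_bimod_realizable R C)) (krull_schmidt_op ksC)
  (additive_op (@triexact_additive R C)) _ X.
  have [E [Z [f [g /almost_split_sequence_almost_zero[d dP]]]]] :=
    assL Y Ysi Yp.
  by exists Z, d; apply: almost_zero_op.
by case=> ? ?; exists Z, theta; apply/serre_pair_stable; split.
Qed.

(** The hypothesis is what a full Auslander-Reiten functor and a Serre pairing both provide. *)
Lemma has_ass_right_of_pre_represents :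
  (forall Z, exists X (theta : dual I (stable_bimod Z X)),
     pre_represents theta /\
     forall b : hom X X, exists a : hom Z Z,
       forall d, evalD (post b d) theta = evalD (pre d a) theta) ->
  has_ass_right C.
Proof.
move=> ex Z Zsi Zp.
have [X [theta [/pre_represents_stable thetaP endo]]] := ex Z.
have [b|X' [d [X'si dP]]] :=
  almost_zero_exists cogI reflC (@ext_bimod_realizable R C) ksC Zsi Zp thetaP.
  have [a aE] := endo (piO b); exists (lift_hom a) => d.
  by rewrite -[RHS]aE; congr evalD; apply/esym/ext_over_proj.
by exists X'; apply: (almost_zero_almost_split_sequence X'si Zsi dP).
Qed.

Lemma has_ass_left_of_post_represents :
  (forall X, exists Z (theta : dual I (stable_bimod Z X)),
     post_represents theta /\
     forall b : hom Z Z, exists a : hom X X,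
       forall d, evalD (pre d b) theta = evalD (post a d) theta) ->
  has_ass_left C.
Proof.
move=> ex X Xsi Xi.
have [Z [theta [/post_represents_stable thetaP endo]]] := ex X.
have /strongly_indecomposable_op Xsi' := Xsi.
have [b|Z' [d [/strongly_indecomposable_op Z'si [d0 dX dZ]]]] :=
  almost_zero_exists cogI (hom_reflexive_op reflC)
    (realizable_op (@ext_bimod_realizable R C)) (krull_schmidt_op ksC)
    Xsi' Xi thetaP.
  have [a aE] := endo (piU b); exists (lift_hom a) => d.
  by rewrite -[RHS]aE; congr evalD; apply/esym/ext_under_proj.
have [|Y [f [g fg]]] := @almost_zero_almost_split_sequence R C X Z' d Xsi Z'si.
  by split.
by exists Y, Z', f, g.
Qed.
End StableBimodule.

(** * Left Auslander-Reiten functors as right ones over opposite categories *)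

Section OppositeFunctor.
Variables (R : comPzRingType) (C D : rcat R).

Definition op_functor (F : functor C D) : functor (op_rcat C) (op_rcat D) :=
  @Functor R (op_rcat C) (op_rcat D) F
    (fun (X Y : C) (f : hom Y X) => fmor F f)
    (fun X => fmor_id F X)
    (fun (X Y Z : C) (g : hom Z Y) (f : hom Y X) => fmor_comp F f g).

Definition unop_functor (F : functor (op_rcat C) (op_rcat D)) : functor C D :=
  @Functor R C D F
    (fun (X Y : C) (f : hom X Y) => @fmor _ _ _ F Y X f)
    (fun X => fmor_id F X)
    (fun (X Y Z : C) (g : hom Y Z) (f : hom X Y) =>
       @fmor_comp _ _ _ F Z Y X f g).

Lemma op_functorP (K : functor C D -> Prop)
    (K' : functor (op_rcat C) (op_rcat D) -> Prop) :
  (forall F, K F -> K' (op_functor F)) ->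
  (forall F, K' F -> K (unop_functor F)) ->
  (exists F, K F) <-> exists F, K' F.
Proof.
move=> KK' K'K; split=> -[F KF].
  by exists (op_functor F); apply: KK'.
by exists (unop_functor F); apply: K'K.
Qed.

Lemma op_functor_equivalence (F : functor C D) :
  equivalence_functor F -> equivalence_functor (op_functor F).
Proof.
case/equivalence_fully_faithful=> full faith surj.
apply: fully_faithful_equivalence => [X Y|X Y|Y]; [exact: full|exact: faith|].
by have [X [f [g [gf fg]]]] := surj Y; exists X, g, f.
Qed.

Lemma unop_functor_equivalence (F : functor (op_rcat C) (op_rcat D)) :
  equivalence_functor F -> equivalence_functor (unop_functor F).
Proof.
case/equivalence_fully_faithful=> full faith surj.
apply: fully_faithful_equivalence => [X Y|X Y|Y]; [exact: full|exact: faith|].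
by have [X [f [g [gf fg]]]] := surj Y; exists X, g, f.
Qed.
End OppositeFunctor.

Section LeftAR.
Variables (R : comPzRingType) (I : lmodType R) (C : triexact R).

(** [Psi] with its arguments exchanged; the naturality conditions agree because the two actions on
    Ext commute. *)
Lemma op_left_AR_functor (tau : functor (over_cat C) (under_cat C)) :
  left_AR_functor I tau ->
  AR_functor I (op_bimod (stable_bimod C)) (op_functor tau).
Proof.
move=> [Psi [Psi_bij PsiN]]; exists (fun X Y => Psi Y X); split=> [X Y|].
  exact: Psi_bij.
move=> X X' Y Y' a b x d.
have -> : b \c x \c a =
    @comp R (over_cat C) _ _ _ (@comp R (over_cat C) _ _ _ a x) b.
  exact: (@compA R (over_cat C)).
apply: (etrans (PsiN _ _ _ _ b a x d)); congr evalD.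
exact/esym/ext_under_over.
Qed.

Lemma unop_left_AR_functor
    (F : functor (op_rcat (over_cat C)) (op_rcat (under_cat C))) :
  AR_functor I (op_bimod (stable_bimod C)) F ->
  left_AR_functor I (unop_functor F).
Proof.
move=> [Phi [Phi_bij PhiN]]; exists (fun X Y => Phi Y X); split=> [X Y|].
  exact: Phi_bij.
move=> X X' Y Y' a b x d.
have -> : b \c x \c a = @comp R (op_rcat (over_cat C)) _ _ _
    (@comp R (op_rcat (over_cat C)) _ _ _ a x) b.
  exact: (esym (@compA R (over_cat C) _ _ _ _ b x a)).
apply: (etrans (PhiN _ _ _ _ b a x d)); congr evalD.
exact: ext_under_over.
Qed.

Lemma full_left_AR_functorP :
  (exists tau : functor (over_cat C) (under_cat C),
     left_AR_functor I tau /\ full_functor tau) <->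
  (exists tau,
     AR_functor I (op_bimod (stable_bimod C)) tau /\ full_functor tau).
Proof.
apply: op_functorP => F [AR full]; split; try by move=> X Y; apply: full.
  exact: op_left_AR_functor.
exact: unop_left_AR_functor.
Qed.

Lemma left_AR_equivalence_op :
  (exists tau : functor (over_cat C) (under_cat C),
     left_AR_equivalence I tau) <->
  (exists tau, AR_functor I (op_bimod (stable_bimod C)) tau /\
     equivalence_functor tau).
Proof.
apply: op_functorP => F [AR eqF]; split.
- exact: op_left_AR_functor.
- exact: op_functor_equivalence.
- exact: unop_left_AR_functor.
- exact: unop_functor_equivalence.
Qed.

(** Serre pairings are self-dual, so passing to opposite categories merely swaps targets and
    sources. *)
Lemma left_AR_equivalenceP :
  (exists tau : functor (over_cat C) (under_cat C),
     left_AR_equivalence I tau) <->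
  has_serre_targets C I /\ has_serre_sources C I.
Proof.
rewrite left_AR_equivalence_op.
rewrite (@AR_equivalenceP R I _ _ (op_bimod (stable_bimod C))
  (@stable_post_faithful R C) (@stable_pre_faithful R C)).
by split=> -[H1 H2]; split=> X; [have [Z [theta [? ?]]] := H2 X
  | have [Z [theta [? ?]]] := H1 X | have [Z [theta [? ?]]] := H2 X
  | have [Z [theta [? ?]]] := H1 X]; exists Z, theta.
Qed.
End LeftAR.

Theorem theorem4p8 (R : comPzRingType) (I : lmodType R) (C : triexact R)
    (hI : minimal_injective_cogenerator I)
    (hHom : hom_reflexive C I) (hKS : krull_schmidt C) :
  ((has_ass_right C <->
      exists tau : functor (under_cat C) (over_cat C),
        right_AR_functor I tau /\ full_functor tau) /\
   (has_ass_left C <->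
      exists tau : functor (over_cat C) (under_cat C),
        left_AR_functor I tau /\ full_functor tau)) /\
  [/\ has_ass C <->
        exists tau : functor (under_cat C) (over_cat C),
          right_AR_equivalence I tau,
      (exists tau : functor (under_cat C) (over_cat C),
          right_AR_equivalence I tau) <->
        exists tau : functor (over_cat C) (under_cat C),
          left_AR_equivalence I tau
    & has_ass C -> ext_reflexive C I].
Proof.
have [injI cogI _] := hI.
have faithU := @stable_pre_faithful R C.
have faithO := @stable_post_faithful R C.
have opfaithU : post_faithful (op_bimod (stable_bimod C)) := faithU.
have opfaithO : pre_faithful (op_bimod (stable_bimod C)) := faithO.
have right_serre : has_ass_right C -> has_serre_targets C I.
  exact: has_ass_right_serre.
have left_serre : has_ass_left C -> has_serre_sources C I.
  exact: has_ass_left_serre.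
have right_equiv : (exists tau : functor (under_cat C) (over_cat C),
    right_AR_equivalence I tau) <->
    has_serre_targets C I /\ has_serre_sources C I.
  exact: AR_equivalenceP faithU faithO.
(* All three conditions of part (2) reduce to the existence of partners on both sides. *)
have assP : has_ass C <-> has_serre_targets C I /\ has_serre_sources C I.
  split=> [[/right_serre ? /left_serre ?] //|[exZ exX]]; split.
    apply: (has_ass_right_of_pre_represents cogI hHom hKS) => Z.
    have [X [theta thetaS]] := exZ Z; exists X, theta.
    by split; [case: thetaS|apply: pre_represents_endo; case: thetaS].
  apply: (has_ass_left_of_post_represents cogI hHom hKS) => X.
  have [Z [theta [thetaP thetaQ]]] := exX X; exists Z, theta; split=> //.
  exact: (@pre_represents_endo R I _ _ (op_bimod (stable_bimod C)) X Z theta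
            thetaQ).
split; first split.
- split=> [/right_serre|[tau [AR full]]].
    exact: full_AR_functor_exists.
  apply: (has_ass_right_of_pre_represents cogI hHom hKS) => Z.
  exact: (full_AR_functor_represents faithU Z AR full).
- rewrite full_left_AR_functorP.
  split=> [/left_serre exX|[tau [AR full]]].
    apply: (full_AR_functor_exists opfaithO opfaithU) => X.
    have [Z [theta /serre_pair_op thetaS]] := exX X; by exists Z, theta.
  apply: (has_ass_left_of_post_represents cogI hHom hKS) => X.
  exact: (full_AR_functor_represents opfaithO X AR full).
split.
- by rewrite assP right_equiv.
- by rewrite right_equiv left_AR_equivalenceP.
(* Once [X] is the target of a Serre pairing with source [Z], [Ext L X] is paired with the reflexive
   module [hom Z L]. *)
move=> /assP[_ exX] L X.
have [Z [theta [/pre_represents_stable thetaP _]]] := exX X.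
exact: (pre_represents_reflexive cogI thetaP (hHom Z L)).
Qed.
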